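(* Let $\alpha,\beta\in\mathbb{R}_+$ with $\alpha\neq2\pi$, let $\mathcal U$ be an open connected subset of $\mathbb{E}^{1,2}_\alpha$ containing a singular point, and let $\phi:\mathcal U\to\mathbb{E}^{1,2}_\beta$ be a continuous function. If the restriction of $\phi$ to the regular part $\mathcal U\cap Reg(\mathbb{E}^{1,2}_\alpha)$ is an injective $\mathbb{E}^{1,2}$-morphism (into $Reg(\mathbb{E}^{1,2}_\beta)$), then $\alpha=\beta$ and $\phi$ is the restriction of an element of $\mathrm{Isom}(\mathbb{E}^{1,2}_\alpha)$.
   Context: Notation: $\mathbb{R}_+=[0,+\infty)$. Minkowski space $\mathbb{E}^{1,2}$ is $\mathbb{R}^3$ with coordinates $(t,x,y)$, its standard orientation, and the quadratic form $-dt^2+dx^2+dy^2$; causal vectors with positive $t$-component are future causal. $\mathrm{Isom}(\mathbb{E}^{1,2})$ is the group of affine isometries preserving orientation and causal (time) order. An $\mathbb{E}^{1,2}$-manifold is a Hausdorff manifold with an $(\mathrm{Isom}(\mathbb{E}^{1,2}),\mathbb{E}^{1,2})$-structure (i.e. a flat, oriented, time-oriented Lorentzian 3-manifold); an $\mathbb{E}^{1,2}$-morphism is a map which is in charts locally the restriction of an element of $\mathrm{Isom}(\mathbb{E}^{1,2})$. Model spaces. For $\alpha>0$, $\mathbb{E}^{1,2}_\alpha$ is $\mathbb{R}^3$ with cylindrical coordinates $(t,r,\theta)$ and metric $-dt^2+dr^2+\left(\frac{\alpha}{2\pi}\right)^2r^2d\theta^2$; $\mathbb{E}^{1,2}_0$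 (BTZ model) is $\mathbb{R}^3$ with cylindrical coordinates $(\tau,r,\theta)$ and metric $-2\,d\tau\,dr+dr^2+r^2d\theta^2$. Here $\theta\in\mathbb{R}/2\pi\mathbb{Z}$. For $\alpha\neq2\pi$ the singular line is $\mathrm{Sing}(\mathbb{E}^{1,2}_\alpha)=\{r=0\}$, its points are the singular points, and $Reg(\mathbb{E}^{1,2}_\alpha)$ is its complement, an $\mathbb{E}^{1,2}$-manifold oriented by $(t,r,\theta)$ (resp. $(\tau,r,\theta)$) and time-oriented so that $t$ (resp. $\tau$) increases along future causal curves; for $\alpha=2\pi$ the space is $\mathbb{E}^{1,2}$ itself and there are no singular points. $\mathrm{Isom}(\mathbb{E}^{1,2}_\alpha)$ denotes the group of homeomorphisms of $\mathbb{E}^{1,2}_\alpha$ preserving $Reg(\mathbb{E}^{1,2}_\alpha)$ and restricting to an $\mathbb{E}^{1,2}$-isomorphism of it. *)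

(* Defs.v *)
From HB Require Import structures.
From mathcomp Require Import all_boot all_order all_algebra.
From mathcomp Require Import all_classical all_reals all_analysis.
From mathcomp Require Import ring.

Set Implicit Arguments.
Unset Strict Implicit.
Unset Printing Implicit Defensive.

Import Order.TTheory GRing.Theory Num.Theory.
Import numFieldNormedType.Exports.
Local Open Scope classical_set_scope.
Local Open Scope ring_scope.

(* Every model space is R^3 as a topological space.  A point is stored by its
   Cartesian coordinates (t, x, y), where x = r cos theta, y = r sin theta, and
   t stands for tau in the BTZ model; tangent vectors are stored likewise. *)
Notation vec3 R := 'rV[R]_3.

Section Coordinates.
Context {R : realType}.
Implicit Types p v : vec3 R.

Definition tc v : R := v 0 0.
Definition xc v : R := v 0 1.
Definition yc v : R := v 0 2.

Definition mk3 (a b c : R) : vec3 R := \row_(i < 3) [:: a; b; c]`_i.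

Definition radius p : R := Num.sqrt (xc p ^+ 2 + yc p ^+ 2).

(* The 1-forms dr and dtheta in Cartesian coordinates; both are meaningful
   only where the radius is nonzero. *)
Definition dr p v : R := (xc p * xc v + yc p * yc v) / radius p.
Definition dtheta p v : R := (xc p * yc v - yc p * xc v) / radius p ^+ 2.

(* [cyl t r th] is the point of cylindrical coordinates (t, r, th);
   [cyl_tangent r th a b c] is the tangent vector
   a d/dt + b d/dr + c d/dtheta at that point. *)
Definition cyl (t r th : R) : vec3 R := mk3 t (r * cos th) (r * sin th).
Definition cyl_tangent (r th a b c : R) : vec3 R :=
  mk3 a (b * cos th - r * sin th * c) (b * sin th + r * cos th * c).

End Coordinates.

Section Minkowski.
Context {R : realType}.
Implicit Types v : vec3 R.

Definition mink v : R := - tc v ^+ 2 + xc v ^+ 2 + yc v ^+ 2.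

Definition future_causal v : Prop := mink v <= 0 /\ 0 < tc v.

Definition isom_E12 (g : vec3 R -> vec3 R) : Prop :=
  exists (A : 'M[R]_3) (b : vec3 R),
    [/\ forall x, g x = x *m A + b,
        forall v, mink (v *m A) = mink v,
        0 < \det A &
        forall v, future_causal v -> future_causal (v *m A)].

End Minkowski.

Section ModelSpaces.
Context {R : realType}.
Implicit Types (al : R) (p v : vec3 R) (V : set (vec3 R)).

Definition Sing al : set (vec3 R) := [set p | al != 2 * pi /\ radius p = 0].
Definition Reg al : set (vec3 R) := ~` Sing al.

Definition metric al p v : R :=
  if al == 2 * pi then mink v
  else if al == 0 then
    - (2 * tc v * dr p v) + dr p v ^+ 2 + radius p ^+ 2 * dtheta p v ^+ 2
  else
    - tc v ^+ 2 + dr p v ^+ 2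
      + (al / (2 * pi)) ^+ 2 * radius p ^+ 2 * dtheta p v ^+ 2.

(* In every model a nonzero causal vector has a nonzero t- (resp. tau-)
   component. *)
Definition model_future_causal al p v : Prop :=
  metric al p v <= 0 /\ 0 < tc v.

(* [Ck k V f] : f is of class C^k on the open set V. *)
Fixpoint Ck (k : nat) V (f : vec3 R -> vec3 R) : Prop :=
  match k with
  | 0%N => forall p, V p -> {for p, continuous f}
  | k'.+1 => (forall p, V p -> differentiable f p) /\
             forall i : 'I_3, Ck k' V (fun p => 'D_(delta_mx 0 i) f p)
  end.

(* The charts of the E^{1,2}-structure on the regular part: injective smooth
   local isometries into Minkowski space compatible with the orientation and
   the time orientation (they are open maps by the inverse function theorem).
   The frame (t, x, y) has the orientation of (t, r, theta), since
   dx /\ dy = r dr /\ dtheta. *)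
Definition is_chart al V (psi : vec3 R -> vec3 R) : Prop :=
  [/\ open V /\ V `<=` Reg al,
      {in V &, injective psi},
      forall k, Ck k V psi,
      forall p, V p -> 0 < \det (jacobian psi p) &
      forall p, V p ->
        (forall v, mink ('d psi p v) = metric al p v) /\
        (forall v, model_future_causal al p v -> future_causal ('d psi p v))].

(* W is meant to be an open subset of Reg al, so that [\near p] stays in W. *)
Definition E12_morphism al be (W : set (vec3 R)) (f : vec3 R -> vec3 R) : Prop :=
  f @` W `<=` Reg be /\
  forall p, W p -> exists V psi V' psi' g,
    [/\ is_chart al V psi /\ V p, is_chart be V' psi' /\ V' (f p), isom_E12 g &
        \forall q \near p, V' (f q) /\ psi' (f q) = g (psi q)].

Definition isom_model al (h : vec3 R -> vec3 R) : Prop :=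
  exists k : vec3 R -> vec3 R,
    [/\ cancel h k /\ cancel k h,
        continuous h /\ continuous k,
        h @` Reg al = Reg al,
        E12_morphism al al (Reg al) h &
        E12_morphism al al (Reg al) k].

End ModelSpaces.

Section CylindricalForm.
Context {R : realType}.
Implicit Types (al t r th a b c : R).

Lemma tc_mk3 a b c : tc (mk3 a b c) = a. Proof. by rewrite /tc mxE. Qed.
Lemma xc_mk3 a b c : xc (mk3 a b c) = b. Proof. by rewrite /xc mxE. Qed.
Lemma yc_mk3 a b c : yc (mk3 a b c) = c. Proof. by rewrite /yc mxE. Qed.

Lemma radius_cyl t r th : 0 <= r -> radius (cyl t r th) = r.
Proof.
move=> r0; rewrite /radius xc_mk3 yc_mk3 !exprMn -mulrDr cos2Dsin2 mulr1.
by rewrite sqrtr_sqr ger0_norm.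
Qed.

Lemma dr_cyl t r th a b c : 0 < r ->
  dr (cyl t r th) (cyl_tangent r th a b c) = b.
Proof.
move=> r0; rewrite /dr radius_cyl ?ltW// !xc_mk3 !yc_mk3.
rewrite [X in X / _](_ : _ = b * (cos th ^+ 2 + sin th ^+ 2) * r); last by ring.
by rewrite cos2Dsin2 mulr1 mulfK ?gt_eqF.
Qed.

Lemma dtheta_cyl t r th a b c : 0 < r ->
  dtheta (cyl t r th) (cyl_tangent r th a b c) = c.
Proof.
move=> r0; rewrite /dtheta radius_cyl ?ltW// !xc_mk3 !yc_mk3.
rewrite [X in X / _](_ : _ = c * (cos th ^+ 2 + sin th ^+ 2) * r ^+ 2); last by ring.
by rewrite cos2Dsin2 mulr1 mulfK// expf_neq0 ?gt_eqF.
Qed.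

(* At al = 2 pi this is the Minkowski form in cylindrical coordinates. *)
Lemma metric_cyl_massive al t r th a b c : al != 0 -> 0 < r ->
  metric al (cyl t r th) (cyl_tangent r th a b c) =
    - a ^+ 2 + b ^+ 2 + (al / (2 * pi)) ^+ 2 * r ^+ 2 * c ^+ 2.
Proof.
move=> al0 r0; rewrite /metric (negbTE al0).
case: eqVneq => [->|_]; last first.
  by rewrite dr_cyl// dtheta_cyl// radius_cyl ?ltW// tc_mk3.
rewrite divff ?mulf_neq0 ?pnatr_eq0 ?gt_eqF ?pi_gt0// expr1n mul1r.
rewrite /mink tc_mk3 xc_mk3 yc_mk3.
rewrite -[b ^+ 2 in RHS]mulr1 -[r ^+ 2 * _ in RHS]mulr1 -(cos2Dsin2 th); ring.
Qed.

Lemma metric_cyl_BTZ t r th a b c : 0 < r ->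
  metric 0 (cyl t r th) (cyl_tangent r th a b c) =
    - (2 * a * b) + b ^+ 2 + r ^+ 2 * c ^+ 2.
Proof.
move=> r0; rewrite /metric eqxx.
rewrite (_ : _ == _ = false); last first.
  by apply/negbTE; rewrite eq_sym mulf_neq0 ?pnatr_eq0 ?gt_eqF ?pi_gt0.
by rewrite dr_cyl// dtheta_cyl// radius_cyl ?ltW// tc_mk3.
Qed.

End CylindricalForm.

(* Main.v *)
Require Import Defs.
From HB Require Import structures.
From mathcomp Require Import all_boot all_order all_algebra.
From mathcomp Require Import all_classical all_reals all_analysis.
From mathcomp Require Import ring lra.

(* In cylindrical coordinates a chart of a model space is, up to an isometry,
   an explicit developing map [dev], because two maps pulling back flat metrics
   to the same metric differ by an affine isometry.  On a cylinder minus its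
   axis, phi therefore lifts to one affine isometry (M, c) between the
   developing maps.  If phi sends an axis point to a regular point, a chart
   there makes [dev] both 2 pi-periodic and injective modulo 2 pi in theta, so
   that alpha = 2 pi.  Otherwise (M, c) preserves the axis direction: it is
   timelike in the massive models and null in the BTZ model, so both models are
   of the same type, and the form of M together with the injectivity of phi
   (winding number one) forces alpha = beta and makes phi a rotation composed
   with a translation along the axis.  Connectedness of U propagates this. *)

Set Implicit Arguments.
Unset Strict Implicit.
Unset Printing Implicit Defensive.

Import Order.TTheory GRing.Theory Num.Theory.
Import numFieldNormedType.Exports.
Local Open Scope classical_set_scope.
Local Open Scope ring_scope.


(** * Symmetry of second derivatives *)

(** A developing map lives on a universal cover, and phi has no canonical lift there: the lifted
    angle is fixed only up to 2 pi n. Instead of covering theory, points of the cover are triples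
    (t, r, theta) with theta real, lifts are germs, and a change of lift acts on [dev] by a linear
    map, hence on the pair (M, c). A lemma on locally constant indices over a connected set then
    replaces path lifting; it also serves to propagate the result along U. Near the axis the
    obstacle is that the angle of the lift of phi is not controlled as r tends to 0, so only
    identities free of theta are passed to the limit. The value beta = 2 pi has to be excluded
    before the developing map of the target can be used, so the argument in a chart of the target is
    carried out for every beta. Apart from the identity of Minkowski space, no chart is built from
    scratch: the morphism property supplies one, and similarities fixing the axis carry it to any
    regular point. *)

Section Calculus.
Context {R : realType} {V : normedModType R}.

Lemma diff_approx (W : normedModType R) (f : V -> W) p : differentiable f p ->
  forall e, 0 < e ->
    \forall w \near (0 : V), `|f (p + w) - f p - 'd f p w| <= e * `|w|.
Proof.
move=> df e e0; have /diff_locally/eqaddoP/(_ e e0) := df.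
apply: filterS => w /=; rewrite !fctE /= opprD addrA.
by rewrite [w + p]addrC.
Qed.

Lemma near_eq_diff (W : normedModType R) (f g : V -> W) p :
  (\forall x \near p, f x = g x) -> differentiable f p ->
  differentiable g p /\ 'd g p = 'd f p :> (V -> W).
Proof.
move=> fg df.
have key : g \o shift p = cst (g p) + 'd f p +o_ 0 id.
  apply/eqaddoP => e e0.
  have gfp : g p = f p by rewrite -(nbhs_singleton fg).
  have /diff_locally/eqaddoP/(_ e e0) := df.
  have : \forall w \near (0 : V), f (w + p) = g (w + p).
    move: fg; rewrite (near_shift 0) subr0; exact.
  apply: filterS2 => w /= E; rewrite !fctE /= -gfp E; exact.
have dE : 'd g p = 'd f p :> (V -> W) by apply: diff_unique; [exact: diff_continuous|].
split => //; apply/diff_locallyP; rewrite dE; split => //; exact: diff_continuous.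
Unshelve. all: by end_near. Qed.

Lemma is_derive_line (W : normedModType R) (f : V -> W) p v (s : R) :
  differentiable f (p + s *: v) ->
  is_derive s 1 (fun s => f (p + s *: v)) ('d f (p + s *: v) v).
Proof.
move=> df.
have dl : is_diff s (fun s : R => p + s *: v) (fun s => s *: v).
  have -> : (fun s : R => p + s *: v) = cst p + (fun s => s *: v) by [].
  apply: (is_diff_eq (is_diffD (is_diff_cst p s) (is_diff_scalel s v))).
  by rewrite add0r.
have /differentiableP dff := df.
have dc := @is_diff_comp _ _ _ _ (fun s : R => p + s *: v) _ f _ s dl dff.
split; first by apply/derivable1_diffP; have [] := dc.
by rewrite deriveE ?ex_diff// diff_val /= scale1r.
Qed.

Lemma MVT_line (g : V -> R) p v (s : R) : 0 < s ->
  (forall x, 0 <= x <= s -> differentiable g (p + x *: v)) ->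
  exists2 x, 0 < x < s & g (p + s *: v) - g p = s * 'd g (p + x *: v) v.
Proof.
move=> s0 dg.
have [| |c cs E] := @MVT R (fun x => g (p + x *: v))
    (fun x => 'd g (p + x *: v) v) 0 s s0.
- move=> x /[!in_itv]/= /andP[x0 xs]; apply: is_derive_line; apply: dg.
  by rewrite !ltW.
- apply: derivable_within_continuous => x /[!in_itv]/= xs.
  by have [] := is_derive_line (dg x xs).
- exists c; first by move: cs; rewrite in_itv.
  by move: E; rewrite scale0r addr0 subr0 mulrC.
Qed.

Lemma diff0_const_ball (g : V -> R) p r :
  (forall x, ball p r x -> differentiable g x /\ 'd g x = 0 :> (V -> R)) ->
  forall x, ball p r x -> g x = g p.
Proof.
move=> dg x; rewrite -ball_normE /= => px.
have seg y : 0 <= y <= 1 -> ball p r (p + y *: (x - p)).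
  move=> /andP[y0 y1]; rewrite -ball_normE /= opprD addNKr normrN normrZ.
  rewrite (ger0_norm y0) (le_lt_trans _ px)// -[leRHS]mul1r distrC.
  by rewrite ler_wpM2r.
have [|y /andP[y0 y1]] := @MVT_line g p (x - p) 1 ltr01.
  by move=> y /seg/dg[].
rewrite scale1r [p + _]addrC subrK (dg _ (seg y _)).2 ?ltW// mulr0 => /eqP.
by rewrite subr_eq0 => /eqP.
Qed.

(* The mean value theorem applied to [x |-> g (p + x u + s v) - g (p + x u)]
   compares this second difference, which is symmetric in u and v, with
   [s ^+ 2 * D_v D_u g]. *)
Lemma second_difference (g : V -> R) p u v :
  (\forall x \near p, differentiable g x) ->
  differentiable (fun x => 'd g x u) p -> forall e, 0 < e ->
  \forall s \near (0 : R)^'+,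
    `|g (p + s *: v + s *: u) - g (p + s *: v) - (g (p + s *: u) - g p)
      - s ^+ 2 * 'd (fun x => 'd g x u) p v| <= e * s ^+ 2.
Proof.
move=> dg dgu e e0; set h := fun x => 'd g x u.
(* Two errors of size e / c times s (|u| + |v|) occur below; dividing e by c keeps their sum under e
   s, and the 1 keeps c positive when u and v vanish. *)
set c := 2 * (`|u| + `|v|) + 1.
have c0 : 0 < c by rewrite ltr_wpDl// mulr_ge0// addr_ge0.
have /= := diff_approx dgu (divr_gt0 e0 c0).
move=> /nbhs_ballP[d1 /= d1_gt0 H1].
move/nbhs_ballP: dg => [d2 /= d2_gt0 H2].
set N := `|u| + `|v| + 1.
have N0 : 0 < N by rewrite ltr_wpDl// addr_ge0.
near=> s.
have s0 : 0 < s by near: s; exact: nbhs_right_gt.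
have sd1 : s * N < d1.
  by rewrite -ltr_pdivlMr//; near: s; apply: nbhs_right_lt; rewrite divr_gt0.
have sd2 : s * N < d2.
  by rewrite -ltr_pdivlMr//; near: s; apply: nbhs_right_lt; rewrite divr_gt0.
have small x y : 0 <= x <= s -> 0 <= y <= s ->
    `|y *: v + x *: u| <= s * (`|u| + `|v|).
  move=> /andP[x0 xs] /andP[y0 ys]; rewrite (le_trans (ler_normD _ _))//.
  by rewrite !normrZ !ger0_norm// addrC mulrDr lerD// ler_wpM2r.
have small1 x y : 0 <= x <= s -> 0 <= y <= s -> `|y *: v + x *: u| < s * N.
  move=> xs ys; rewrite (le_lt_trans (small _ _ xs ys))//.
  by rewrite ltr_pM2l// ltrDl.
have dif x y : 0 <= x <= s -> 0 <= y <= s ->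
    differentiable g (p + y *: v + x *: u).
  move=> xs ys; apply: H2; rewrite -ball_normE /= -addrA opprD addNKr normrN.
  exact: lt_trans (small1 _ _ xs ys) sd2.
have apx x y : 0 <= x <= s -> 0 <= y <= s ->
    `|h (p + (y *: v + x *: u)) - h p - 'd h p (y *: v + x *: u)|
      <= e / c * (s * (`|u| + `|v|)).
  move=> xs ys; have := H1 (y *: v + x *: u); rewrite -ball_normE /= sub0r normrN.
  move=> /(_ (lt_trans (small1 _ _ xs ys) sd1)) /le_trans; apply.
  by rewrite ler_wpM2l ?small// divr_ge0 ?ltW.
pose G := fun x => g (x + s *: v) - g x.
have sI : 0 <= s <= s by rewrite lexx ltW.
have oI : 0 <= (0 : R) <= s by rewrite lexx ltW.
have dG x : 0 <= x <= s -> is_diff (p + x *: u) G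
    (('d g (p + s *: v + x *: u) : V -> R) - ('d g (p + x *: u) : V -> R)).
  move=> xs; have d1g := differentiableP (dif _ _ xs sI).
  have := dif _ _ xs oI; rewrite scale0r addr0 => /differentiableP d0g.
  have tr : is_diff (p + x *: u) (fun y => y + s *: v) id.
    by apply: is_diff_eq; rewrite addr0.
  have d1' : is_diff (p + x *: u) (g \o (fun y => y + s *: v))
      ('d g (p + s *: v + x *: u)).
    rewrite -[X in is_diff _ _ X]/(_ \o id).
    by apply: (is_diff_comp tr); rewrite /= addrAC.
  exact: is_diffB.
have [x xs|x /andP[x0 xs] E] := @MVT_line G p u s s0.
  by have [] := dG _ xs.
have {x0}xs : 0 <= x <= s by rewrite !ltW.
rewrite (_ : g _ - _ - _ = G (p + s *: u) - G p); last first.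
  by rewrite /G [p + s *: u + _]addrAC; ring.
rewrite {}E; have [_ ->] := dG _ xs; rewrite !fctE.
rewrite -[p + s *: v + _]addrA.
have A1 := apx _ _ xs sI; have := apx _ _ xs oI.
rewrite scale0r add0r -/(h _) -/(h (p + x *: u)) => A0.
rewrite expr2 -mulrA -mulrBr normrM (ger0_norm (ltW s0)) [e * _]mulrCA.
rewrite ler_pM2l//.
have -> : h (p + (s *: v + x *: u)) - h (p + x *: u) - s * 'd h p v =
  (h (p + (s *: v + x *: u)) - h p - 'd h p (s *: v + x *: u)) -
  (h (p + x *: u) - h p - 'd h p (x *: u)).
  have sv : 'd h p (s *: v) = s * 'd h p v by rewrite linearZ.
  by rewrite linearD sv /=; ring.
rewrite (le_trans (ler_normB _ _))// (le_trans (lerD A1 A0))//.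
rewrite -/(_ + _); set m := `|u| + `|v|.
have -> : e / c * (s * m) + e / c * (s * m) = e * s * (2 * m / c) by ring.
by rewrite -[leRHS]mulr1 ler_wpM2l ?mulr_ge0 ?ltW// ltr_pdivrMr// mul1r ltrDl.
Unshelve. all: by end_near. Qed.

(** Both iterated derivatives, multiplied by s ^ 2, lie within e s ^ 2 / 2 of one and the same
    second difference. The first derivatives have to be differentiable at p only: this is Young's
    form of Schwarz's theorem. *)
Lemma diff2_sym (g : V -> R) p u v :
  (\forall x \near p, differentiable g x) ->
  differentiable (fun x => 'd g x u) p -> differentiable (fun x => 'd g x v) p ->
  'd (fun x => 'd g x u) p v = 'd (fun x => 'd g x v) p u.
Proof.
move=> dg du dv; apply/eqP; rewrite -subr_eq0 -normr_le0.
apply/ler_addgt0Pr => e e0; rewrite add0r.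
have e2 : 0 < e / 2 by rewrite divr_gt0.
have /filter_ex[s [s0 [H1 H2]]] : \forall s \near (0 : R)^'+, 0 < s /\
  (`|g (p + s *: v + s *: u) - g (p + s *: v) - (g (p + s *: u) - g p)
      - s ^+ 2 * 'd (fun x => 'd g x u) p v| <= e / 2 * s ^+ 2 /\
  `|g (p + s *: u + s *: v) - g (p + s *: u) - (g (p + s *: v) - g p)
      - s ^+ 2 * 'd (fun x => 'd g x v) p u| <= e / 2 * s ^+ 2).
  near=> s; split; last split; near: s.
  - exact: nbhs_right_gt.
  - exact: second_difference.
  - exact: second_difference.
rewrite -(@ler_pM2r _ (s ^+ 2)) ?exprn_gt0//.
rewrite -[X in _ * X <= _]ger0_norm ?sqr_ge0// -normrM.
move: H2; rewrite [p + s *: u + _]addrAC => H2.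
move: H1 H2; rewrite !ler_norml => /andP[H1 H1'] /andP[H2 H2'].
set a := 'd _ p v in H1 H1' *; set b := 'd _ p u in H2 H2' *.
by apply/andP; split; lra.
Unshelve. all: by end_near. Qed.

End Calculus.


(** * Pulled back flat metrics *)

Section Vectors.
Context {R : realType}.
Implicit Types (u v w : vec3 R) (M : 'M[R]_3).

Lemma sum3E (F : 'I_3 -> R) : \sum_(i < 3) F i = F 0 + F 1 + F 2.
Proof.
rewrite !big_ord_recl big_ord0 addr0 addrA.
by congr (F _ + F _ + F _); apply/val_inj.
Qed.

Lemma ord3_ind (P : 'I_3 -> Prop) : P 0 -> P 1 -> P 2 -> forall i, P i.
Proof.
move=> P0 P1 P2 [[|[|[|//]]] i3].
- by rewrite (_ : Ordinal _ = 0)//; apply/val_inj.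
- by rewrite (_ : Ordinal _ = 1)//; apply/val_inj.
- by rewrite (_ : Ordinal _ = 2)//; apply/val_inj.
Qed.

Lemma vec3P u v : tc u = tc v -> xc u = xc v -> yc u = yc v -> u = v.
Proof. by move=> *; apply/rowP; apply: ord3_ind. Qed.

Lemma mk3E v : v = mk3 (tc v) (xc v) (yc v).
Proof. by apply: vec3P; rewrite ?tc_mk3 ?xc_mk3 ?yc_mk3. Qed.

Lemma tcD u v : tc (u + v) = tc u + tc v. Proof. by rewrite /tc mxE. Qed.
Lemma xcD u v : xc (u + v) = xc u + xc v. Proof. by rewrite /xc mxE. Qed.
Lemma ycD u v : yc (u + v) = yc u + yc v. Proof. by rewrite /yc mxE. Qed.
Lemma tcN v : tc (- v) = - tc v. Proof. by rewrite /tc mxE. Qed.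
Lemma xcN v : xc (- v) = - xc v. Proof. by rewrite /xc mxE. Qed.
Lemma ycN v : yc (- v) = - yc v. Proof. by rewrite /yc mxE. Qed.
Lemma tcZ a v : tc (a *: v) = a * tc v. Proof. by rewrite /tc mxE. Qed.
Lemma xcZ a v : xc (a *: v) = a * xc v. Proof. by rewrite /xc mxE. Qed.
Lemma ycZ a v : yc (a *: v) = a * yc v. Proof. by rewrite /yc mxE. Qed.
Lemma tc0 : tc (0 : vec3 R) = 0. Proof. by rewrite /tc mxE. Qed.
Lemma xc0 : xc (0 : vec3 R) = 0. Proof. by rewrite /xc mxE. Qed.
Lemma yc0 : yc (0 : vec3 R) = 0. Proof. by rewrite /yc mxE. Qed.

Lemma tcM v M : tc (v *m M) = tc v * M 0 0 + xc v * M 1 0 + yc v * M 2 0.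
Proof. by rewrite /tc mxE sum3E. Qed.
Lemma xcM v M : xc (v *m M) = tc v * M 0 1 + xc v * M 1 1 + yc v * M 2 1.
Proof. by rewrite /xc mxE sum3E. Qed.
Lemma ycM v M : yc (v *m M) = tc v * M 0 2 + xc v * M 1 2 + yc v * M 2 2.
Proof. by rewrite /yc mxE sum3E. Qed.

Definition coordE := (tcD, xcD, ycD, tcN, xcN, ycN, tcZ, xcZ, ycZ, tc0, xc0, yc0,
  tcM, xcM, ycM, @tc_mk3 R, @xc_mk3 R, @yc_mk3 R).

(* The Minkowski form for [b = false]; for [b = true] the same form in a basis
   (n, u, e) with n null, which is better suited to the BTZ model. *)
Definition bil (b : bool) u v : R :=
  (if b then - (tc u * xc v + xc u * tc v) else - (tc u * tc v))
  + xc u * xc v + yc u * yc v.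

Lemma bilC b u v : bil b u v = bil b v u.
Proof. by rewrite /bil; case: b; ring. Qed.

Lemma bilDl b u v w : bil b (u + v) w = bil b u w + bil b v w.
Proof. by rewrite /bil !coordE; case: b; ring. Qed.

Lemma bilNl b u w : bil b (- u) w = - bil b u w.
Proof. by rewrite /bil !coordE; case: b; ring. Qed.

Lemma bilDr b u v w : bil b w (u + v) = bil b w u + bil b w v.
Proof. by rewrite !(bilC b w) bilDl. Qed.

Lemma bil_nondegenerate b u : (forall w, bil b u w = 0) -> u = 0.
Proof.
move=> H; have := (H (mk3 1 0 0), H (mk3 0 1 0), H (mk3 0 0 1)).
rewrite /bil !coordE; case: b {H} => -[[h1 h2] h3];
  by apply: vec3P; rewrite !coordE; lra.
Qed.

Lemma bil_polar b b' M : (forall v, bil b' (v *m M) (v *m M) = bil b v v) ->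
  forall u v, bil b' (u *m M) (v *m M) = bil b u v.
Proof.
move=> H u v; have := H (u + v).
rewrite mulmxDl !bilDl !bilDr !H (bilC b v u) (bilC b' (v *m M)).
lra.
Qed.

(** For both forms a nonzero causal vector has a nonzero first coordinate ([causal_tc0]), so the
    sign of that coordinate is a time orientation. *)
Definition fut b v : Prop := bil b v v <= 0 /\ 0 < tc v.

Lemma mink_bil v : mink v = bil false v v.
Proof. by rewrite /mink /bil; ring. Qed.

Lemma causal_tc0 b v : bil b v v <= 0 -> tc v = 0 -> v = 0.
Proof.
rewrite /bil => H tv; move: H; rewrite tv.
have := (sqr_ge0 (xc v), sqr_ge0 (yc v)); rewrite !expr2 => -[h1 h2] H.
have {}H : xc v * xc v + yc v * yc v <= 0 by case: b H; lra.
apply: vec3P; rewrite ?coordE//.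
  by apply/eqP; rewrite -[_ == _]orbb -mulf_eq0; apply/eqP; lra.
by apply/eqP; rewrite -[_ == _]orbb -mulf_eq0; apply/eqP; lra.
Qed.

End Vectors.

(** * Second derivatives are determined by the pulled back metric *)

Section Rigidity.
Context {R : realType}.
Implicit Types f : vec3 R -> vec3 R.

(** Second order differentiability is phrased through directional derivatives, so that no norm on a
    space of linear maps is involved. *)
Definition twice_diff (V W : normedModType R) (f : V -> W) (p : V) :=
  (\forall x \near p, differentiable f x) /\
  forall v : V, differentiable (fun x => 'd f x v) p.

Lemma is_diff_coord (V : normedModType R) n m (F : V -> 'M[R]_(n, m)) p i j :
  differentiable F p ->
  is_diff p (fun x => F x i j) (fun u => 'd F p u i j).
Proof.
move=> dF.
pose c (M : 'M[R]_(n, m)) : R := M i j.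
have lc : linear c by move=> a M N; rewrite /c !mxE.
pose cM := GRing.isLinear.Build _ _ _ _ _ lc.
pose cL : {linear _ -> _} := HB.pack c cM.
have cc : continuous cL by exact: coord_continuous.
have /differentiableP := dF.
have : is_diff (F p) c c.
  rewrite -[c]/(cL : _ -> _).
  by split; [exact: linear_differentiable|exact: diff_lin].
by move=> h1 h2; exact: (is_diff_comp h2 h1).
Qed.

Lemma differentiable_bigsum (V : normedModType R) (I : Type) (r : seq I)
    (P : pred I) (F : I -> V -> R) p : (forall i, P i -> differentiable (F i) p) ->
  differentiable (fun x => \sum_(i <- r | P i) F i x) p.
Proof.
move=> dF; rewrite (_ : (fun x => _) = \sum_(i <- r | P i) F i); last first.
  by apply/funext => x; rewrite fct_sumE.
elim/big_ind : _ => [|f g df dg|i Pi]; [exact: differentiable_cst| |exact: dF].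
exact: differentiableD.
Qed.

Lemma differentiable_bigprod (V : normedModType R) (I : Type) (r : seq I)
    (P : pred I) (F : I -> V -> R) p : (forall i, P i -> differentiable (F i) p) ->
  differentiable (fun x => \prod_(i <- r | P i) F i x) p.
Proof.
move=> dF; elim: r => [|i r IH].
  by under eq_fun do rewrite big_nil; exact: differentiable_cst.
under eq_fun do rewrite big_cons.
have [Pi|_] := boolP (P i); last exact: IH.
by apply: differentiableM => //; exact: dF.
Qed.

Lemma differentiable_det (V : normedModType R) n (F : V -> 'M[R]_n) p :
  (forall i j, differentiable (fun x => F x i j) p) ->
  differentiable (fun x => \det (F x)) p.
Proof.
move=> dF; apply: differentiable_bigsum => s _.
apply: (@differentiableM _ _ (cst _)); first exact: differentiable_cst.
exact: differentiable_bigprod.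
Qed.

Lemma differentiable_adj (V : normedModType R) n (F : V -> 'M[R]_n) p i j :
  (forall i j, differentiable (fun x => F x i j) p) ->
  differentiable (fun x => (\adj (F x)) i j) p.
Proof.
move=> dF; under eq_fun do rewrite mxE.
apply: (@differentiableM _ _ (cst _)); first exact: differentiable_cst.
apply: differentiable_det => k l; under eq_fun do rewrite !mxE.
exact: dF.
Qed.

Lemma is_diff_bil (V : normedModType R) b (F G : V -> vec3 R) p :
  differentiable F p -> differentiable G p ->
  is_diff p (fun x => bil b (F x) (G x))
    (fun u => bil b ('d F p u) (G p) + bil b (F p) ('d G p u)).
Proof.
have gen (f0 f1 f2 g0 g1 g2 f0' f1' f2' g0' g1' g2' : V -> R) :
  is_diff p f0 f0' -> is_diff p f1 f1' -> is_diff p f2 f2' ->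
  is_diff p g0 g0' -> is_diff p g1 g1' -> is_diff p g2 g2' ->
  is_diff p (fun x => (if b then - (f0 x * g1 x + f1 x * g0 x)
                       else - (f0 x * g0 x)) + f1 x * g1 x + f2 x * g2 x)
    (fun u => (if b then - (f0' u * g1 p + f1' u * g0 p)
               else - (f0' u * g0 p)) + f1' u * g1 p + f2' u * g2 p +
              ((if b then - (f0 p * g1' u + f1 p * g0' u)
               else - (f0 p * g0' u)) + f1 p * g1' u + f2 p * g2' u)).
  case: b => F0 F1 F2 G0 G1 G2.
    apply: (is_diff_eq (is_diffD (is_diffD (is_diffN
      (is_diffD (is_diffM F0 G1) (is_diffM F1 G0))) (is_diffM F1 G1))
      (is_diffM F2 G2))).
    by apply/funext => u; rewrite !fctE /GRing.scale /=; ring.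
  apply: (is_diff_eq (is_diffD (is_diffD (is_diffN
    (is_diffM F0 G0)) (is_diffM F1 G1)) (is_diffM F2 G2))).
  by apply/funext => u; rewrite !fctE /GRing.scale /=; ring.
by move=> dF dG; apply: gen; exact: is_diff_coord.
Qed.

Lemma diff2_sym_vec f (p u v : vec3 R) : twice_diff f p ->
  'd (fun x => 'd f x u) p v = 'd (fun x => 'd f x v) p u.
Proof.
move=> [df d2f]; apply/rowP => j.
have E w : \forall x \near p, ('d f x w) 0 j = 'd (fun x => f x 0 j) x w.
  by near=> x; rewrite (@diff_val _ _ _ _ _ _ _ (is_diff_coord 0 j (near df x _))).
have [d1u h1u] := @is_diff_coord _ _ _ _ p 0 j (d2f u).
have [d1v h1v] := @is_diff_coord _ _ _ _ p 0 j (d2f v).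
have [du eu] := near_eq_diff (E u) d1u; have [dv ev] := near_eq_diff (E v) d1v.
have df' : \forall x \near p, differentiable (fun x => f x 0 j) x.
  by near=> x; apply: (@ex_diff _ _ _ _ _ _ _ (is_diff_coord 0 j (near df x _))).
have S := diff2_sym df' du dv.
by rewrite -(congr1 (@^~ v) (etrans eu h1u)) -(congr1 (@^~ u) (etrans ev h1v)).
Unshelve. all: by end_near. Qed.

Lemma diffDvec (V W : normedModType R) (f : V -> W) p v w :
  'd f p (v + w) = 'd f p v + 'd f p w.
Proof. exact: linearD. Qed.

Lemma twice_diff_bil b f p v w : twice_diff f p ->
  is_diff p (fun x => bil b ('d f x v) ('d f x w))
    (fun u => bil b ('d (fun x => 'd f x v) p u) ('d f p w) +
              bil b ('d f p v) ('d (fun x => 'd f x w) p u)).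
Proof. by move=> [_ d2]; exact: is_diff_bil. Qed.

Lemma pullback_polar b1 b2 (D1 D2 : vec3 R -> vec3 R) :
  {morph D1 : v w / v + w} -> {morph D2 : v w / v + w} ->
  (forall v, bil b2 (D2 v) (D2 v) = bil b1 (D1 v) (D1 v)) ->
  forall v w, bil b2 (D2 v) (D2 w) = bil b1 (D1 v) (D1 w).
Proof.
move=> A1 A2 E v w; have := E (v + w).
rewrite A1 A2 !bilDl !bilDr !E.
rewrite (bilC b1 (D1 w)) (bilC b2 (D2 w)); lra.
Qed.

(* [H1] and [H2] stand for second derivatives; the last hypothesis is the
   derivative of the equality of the pulled back metrics. *)
Lemma koszul_formula b1 b2 (D1 D2 : vec3 R -> vec3 R)
    (H1 H2 : vec3 R -> vec3 R -> vec3 R) :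
  (forall u v, H1 u v = H1 v u) -> (forall u v, H2 u v = H2 v u) ->
  (forall a b c, bil b2 (H2 a c) (D2 b) + bil b2 (D2 a) (H2 b c) =
                 bil b1 (H1 a c) (D1 b) + bil b1 (D1 a) (H1 b c)) ->
  forall u v w, bil b2 (H2 v u) (D2 w) = bil b1 (H1 v u) (D1 w).
Proof.
move=> S1 S2 E u v w; have := (E v w u, E w u v, E u v w).
rewrite (S1 w v) (S1 w u) (S1 u v) (S2 w v) (S2 w u) (S2 u v).
rewrite !(bilC b2 (D2 _)) !(bilC b1 (D1 _)) => -[[]]; lra.
Qed.

(** Differentiating the equality of the two pulled back metrics yields the hypothesis of
    [koszul_formula]; the common value plays the part of the Christoffel symbols. *)
Lemma second_derivative_determined b1 b2 f1 f2 p :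
  twice_diff f1 p -> twice_diff f2 p ->
  (\forall x \near p, forall v,
    bil b2 ('d f2 x v) ('d f2 x v) = bil b1 ('d f1 x v) ('d f1 x v)) ->
  forall u v w, bil b2 ('d (fun x => 'd f2 x v) p u) ('d f2 p w) =
                bil b1 ('d (fun x => 'd f1 x v) p u) ('d f1 p w).
Proof.
move=> t1 t2 iso.
have iso2 : \forall x \near p, forall v w,
    bil b2 ('d f2 x v) ('d f2 x w) = bil b1 ('d f1 x v) ('d f1 x w).
  apply: filterS iso => x; apply: pullback_polar; exact: diffDvec.
apply: (@koszul_formula _ _ ('d f1 p) ('d f2 p) (fun v u => 'd (fun x => 'd f1 x v) p u)
  (fun v u => 'd (fun x => 'd f2 x v) p u)).
- by move=> u v; exact: diff2_sym_vec.
- by move=> u v; exact: diff2_sym_vec.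
move=> a b c.
have D1 := twice_diff_bil b1 a b t1; have D2 := twice_diff_bil b2 a b t2.
have N : \forall x \near p, bil b1 ('d f1 x a) ('d f1 x b) =
    bil b2 ('d f2 x a) ('d f2 x b) by apply: filterS iso2 => x E; apply/esym/E.
have [_ h] := near_eq_diff N (@ex_diff _ _ _ _ _ _ _ D1).
have := etrans (esym (@diff_val _ _ _ _ _ _ _ D2)) (etrans h (@diff_val _ _ _ _ _ _ _ D1)).
by move=> /(congr1 (@^~ c)).
Qed.

End Rigidity.


(** * Constancy of the transition matrix *)

Section TransitionMatrix.
Context {R : realType}.
Implicit Types f : vec3 R -> vec3 R.

Lemma mul_jacobian f p v : v *m jacobian f p = 'd f p v.
Proof. by rewrite /jacobian mul_rV_lin1. Qed.

Lemma is_diff_dot3 (V : normedModType R) (a m a' m' : 'I_3 -> V -> R) p :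
  (forall i, is_diff p (a i) (a' i)) -> (forall i, is_diff p (m i) (m' i)) ->
  is_diff p (fun x => \sum_i a i x * m i x)
    (fun u => \sum_i (a' i u * m i p + a i p * m' i u)).
Proof.
move=> da dm.
rewrite (_ : (fun x => \sum_i a i x * m i x) =
    a 0 * m 0 + a 1 * m 1 + a 2 * m 2); last first.
  by apply/funext => x; rewrite sum3E.
apply: (is_diff_eq (is_diffD (is_diffD (is_diffM (da 0) (dm 0))
  (is_diffM (da 1) (dm 1))) (is_diffM (da 2) (dm 2)))).
apply/funext => u; rewrite sum3E.
by move: (a 0) (a 1) (a 2) (m 0) (m 1) (m 2) (a' 0) (a' 1) (a' 2) (m' 0) (m' 1)
  (m' 2) => *; rewrite !fctE /GRing.scale /=; ring.
Qed.

(* This is [A^-1 B], written so that its entries are visibly differentiable. *)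
Definition transition (A B : 'M[R]_3) : 'M[R]_3 :=
  \matrix_(i, j) ((\det A)^-1 * \sum_k (\adj A) i k * B k j).

Lemma transitionE A B : \det A != 0 -> A *m transition A B = B.
Proof.
move=> A0; have -> : transition A B = (\det A)^-1 *: (\adj A *m B).
  by apply/matrixP => i j; rewrite !mxE.
by rewrite -scalemxAr mulmxA mul_mx_adj mul_scalar_mx scalerA mulVf// scale1r.
Qed.

Lemma row_mulmxE (x : vec3 R) (A : 'M[R]_3) j : (x *m A) 0 j = \sum_k x 0 k * A k j.
Proof. by rewrite mxE. Qed.

Lemma dot_cst_sub (x : R) (a b c : 'I_3 -> R) : x = \sum_k a k * c k ->
  x - \sum_k (a k * c k + b k * 0) = 0.
Proof. by move=> ->; apply/eqP; rewrite subr_eq0; apply/eqP/eq_bigr => k _; ring. Qed.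

Lemma pullback_jacobian b1 b2 A B (D1 D2 : vec3 R -> vec3 R) :
  (forall w, w *m A = D1 w) -> (forall w, w *m B = D2 w) ->
  (forall v, bil b2 (D2 v) (D2 v) = bil b1 (D1 v) (D1 v)) ->
  forall v, bil b2 (v *m B) (v *m B) = bil b1 (v *m A) (v *m A).
Proof. by move=> E1 E2 iso v; rewrite E1 E2. Qed.

Lemma transition_row A B (w w1 w2 : vec3 R) j : \det A != 0 ->
  w *m A = w1 -> w *m B = w2 -> \sum_k w1 0 k * transition A B k j = w2 0 j.
Proof. by move=> A0 <- <-; rewrite -[in RHS](transitionE B A0) mulmxA [RHS]mxE. Qed.

Lemma bil_det_inj b (A : 'M[R]_3) u v : \det A != 0 ->
  (forall w, bil b u (w *m A) = bil b v (w *m A)) -> u = v.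
Proof.
move=> A0 H; apply/eqP; rewrite -subr_eq0; apply/eqP.
apply: (@bil_nondegenerate _ b) => w.
have uA : A \in unitmx by rewrite unitmxE unitfE.
by rewrite -(mulmxKV uA w) bilDl bilNl H subrr.
Qed.

Lemma cancel_jacobian (A : 'M[R]_3) (D : vec3 R -> vec3 R) (c : 'I_3 -> R) :
  \det A != 0 -> (forall w, w *m A = D w) ->
  (forall w : vec3 R, \sum_k (D w) 0 k * c k = 0) -> forall k, c k = 0.
Proof.
move=> A0 DA H k; have uA : A \in unitmx by rewrite unitmxE unitfE.
have := H (delta_mx 0 k *m invmx A); rewrite -DA mulmxKV// (bigD1 k)//= !mxE !eqxx.
rewrite mul1r big1 ?addr0// => i ik.
by rewrite mxE eqxx (negbTE ik) mul0r.
Qed.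

Lemma differentiable_jacobian f p i j :
  twice_diff f p -> differentiable (fun x => jacobian f x i j) p.
Proof.
move=> [_ /(_ (delta_mx 0 i)) d2].
rewrite (_ : (fun x => _) = (fun x => ('d f x (delta_mx 0 i)) 0 j)); last first.
  by apply/funext => x; rewrite -mul_jacobian -rowE [RHS]mxE.
exact: (@ex_diff _ _ _ _ _ _ _ (is_diff_coord 0 j d2)).
Qed.

Lemma differentiable_transition f1 f2 p i j :
  twice_diff f1 p -> twice_diff f2 p -> \det (jacobian f1 p) != 0 ->
  differentiable (fun x => transition (jacobian f1 x) (jacobian f2 x) i j) p.
Proof.
move=> t1 t2 J0; under eq_fun do rewrite mxE.
have dd : differentiable (fun x => \det (jacobian f1 x)) p.
  by apply: differentiable_det => k l; exact: differentiable_jacobian.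
apply: (@differentiableM _ _ (fun x => (\det (jacobian f1 x))^-1)).
  exact: differentiableV.
apply: differentiable_bigsum => k _.
apply: (@differentiableM _ _ (fun x => (\adj (jacobian f1 x)) i k)).
  by apply: differentiable_adj => a l; exact: differentiable_jacobian.
exact: differentiable_jacobian.
Qed.

Lemma transition_iso b1 b2 (A B : 'M[R]_3) : \det A != 0 ->
  (forall v, bil b2 (v *m B) (v *m B) = bil b1 (v *m A) (v *m A)) ->
  forall u v, bil b2 (u *m transition A B) (v *m transition A B) = bil b1 u v.
Proof.
move=> A0 H; apply: bil_polar => v.
have uA : A \in unitmx by rewrite unitmxE unitfE.
by rewrite -(mulmxKV uA v) -[_ *m transition A B]mulmxA transitionE.
Qed.

(** Here u and v stand for second derivatives of the two maps. The transition matrix is an isometry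
    carrying D1 w to D2 w, so the image of u has the same products as v with every D2 w, and
    nondegeneracy concludes. *)
Lemma second_derivative_transition b1 b2 (A B : 'M[R]_3)
    (D1 D2 : vec3 R -> vec3 R) u v :
  \det A != 0 -> \det B != 0 ->
  (forall w, w *m A = D1 w) -> (forall w, w *m B = D2 w) ->
  (forall v, bil b2 (D2 v) (D2 v) = bil b1 (D1 v) (D1 v)) ->
  (forall w, bil b2 v (D2 w) = bil b1 u (D1 w)) -> v = u *m transition A B.
Proof.
move=> A0 B0 E1 E2 iso K; apply: (bil_det_inj (b := b2) B0) => w.
rewrite {1}E2 K -E1 -(@transition_iso b1 b2 A B A0).
  by rewrite -[w *m A *m _]mulmxA transitionE.
by move=> v'; rewrite E1 E2.
Qed.

(** Write T for the transition matrix. Differentiating Df1 T = Df2 gives D^2 f1 T + Df1 dT = D^2 f2,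
    while the Koszul identity gives D^2 f2 = D^2 f1 T. Hence Df1 dT = 0, and Df1 is invertible. *)
Lemma diff_transition0 b1 b2 f1 f2 p i j :
  twice_diff f1 p -> twice_diff f2 p ->
  (\forall x \near p, \det (jacobian f1 x) != 0) ->
  \det (jacobian f2 p) != 0 ->
  (\forall x \near p, forall v,
    bil b2 ('d f2 x v) ('d f2 x v) = bil b1 ('d f1 x v) ('d f1 x v)) ->
  'd (fun x => transition (jacobian f1 x) (jacobian f2 x) i j) p =
    (fun=> 0) :> (vec3 R -> R).
Proof.
move=> t1 t2 J1 J2 iso.
pose m k x := transition (jacobian f1 x) (jacobian f2 x) k j.
have J1p := nbhs_singleton J1.
have dm k : differentiable (m k) p by exact: differentiable_transition.
apply/funext => u.
apply: (cancel_jacobian (c := fun k => 'd (m k) p u) J1p (mul_jacobian f1 p)) => w.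
have [_ d21] := t1; have [_ d22] := t2.
have D := is_diff_dot3 (fun k => is_diff_coord 0 k (d21 w))
  (fun k => differentiableP (dm k)).
have N : \forall x \near p,
    \sum_k ('d f1 x w) 0 k * m k x = ('d f2 x w) 0 j.
  apply: filterS J1 => x J.
  exact: transition_row J (mul_jacobian f1 x w) (mul_jacobian f2 x w).
have [_ E] := near_eq_diff N (@ex_diff _ _ _ _ _ _ _ D).
have {}E := congr1 (@^~ u) (etrans (esym (@diff_val _ _ _ _ _ _ _
  (is_diff_coord 0 j (d22 w)))) (etrans E (@diff_val _ _ _ _ _ _ _ D))).
have K := second_derivative_transition J1p J2 (mul_jacobian f1 p)
  (mul_jacobian f2 p) (nbhs_singleton iso) (second_derivative_determined t1 t2 iso u w).
apply: (@addrI _ (\sum_k ('d (fun x => 'd f1 x w) p u) 0 k * m k p)).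
rewrite addr0 -big_split; apply: etrans (esym E) _.
exact: etrans (congr1 (fun x : vec3 R => x 0 j) K) (row_mulmxE _ _ _).
Qed.

(* The transition matrix between the differentials is constant. *)
Lemma flat_rigidity b1 b2 f1 f2 p :
  (\forall x \near p, [/\ twice_diff f1 x, twice_diff f2 x,
     \det (jacobian f1 x) != 0, \det (jacobian f2 x) != 0 &
     forall v, bil b2 ('d f2 x v) ('d f2 x v) = bil b1 ('d f1 x v) ('d f1 x v)]) ->
  exists M c, [/\ forall u v, bil b2 (u *m M) (v *m M) = bil b1 u v,
    jacobian f2 p = jacobian f1 p *m M &
    \forall x \near p, f2 x = f1 x *m M + c].
Proof.
move=> H; have [r /= r0 Hr] := (nbhs_ballP _ _).1 H.
have near_ball x : ball p r x -> \forall y \near x, ball p r y.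
  by move=> px; apply: open_nbhs_nbhs; split => //; exact: ball_open.
pose m i j x := transition (jacobian f1 x) (jacobian f2 x) i j.
have mcst i j x : ball p r x -> m i j x = m i j p.
  apply: diff0_const_ball => y py; have [t1 t2 J1 J2 iso] := Hr y py.
  split; first exact: differentiable_transition.
  apply: (@diff_transition0 b1 b2) => //.
    by apply: filterS (near_ball _ py) => z /Hr[].
  by apply: filterS (near_ball _ py) => z /Hr[].
set M := transition (jacobian f1 p) (jacobian f2 p).
have [t1p t2p J1p J2p isop] := nbhs_singleton H.
have D x v : ball p r x -> 'd f2 x v = 'd f1 x v *m M.
  move=> px; have [_ _ J1 _ _] := Hr x px.
  have TM : transition (jacobian f1 x) (jacobian f2 x) = M.
    by apply/matrixP => i j; exact: mcst.
  apply: etrans (esym (mul_jacobian f2 x v)) _.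
  apply: etrans (congr1 (mulmx^~ M) (mul_jacobian f1 x v)).
  by rewrite -mulmxA -TM transitionE.
pose g j x : R := f2 x 0 j - \sum_k f1 x 0 k * M k j.
have gcst j x : ball p r x -> g j x = g j p.
  apply: diff0_const_ball => y py.
  have [[d1 _] [d2 _] _ _ _] := Hr y py.
  have D2 := is_diff_coord 0 j (nbhs_singleton d2).
  have D1 := is_diff_dot3 (fun k => is_diff_coord 0 k (nbhs_singleton d1))
    (fun k => is_diff_cst (M k j) y).
  have [dg ->] := is_diffB D2 D1.
  split; first exact: dg.
  apply/funext => v; apply: dot_cst_sub.
  exact: etrans (congr1 (fun z : vec3 R => z 0 j) (D _ _ py)) (row_mulmxE _ _ _).
exists M, (f2 p - f1 p *m M); split.
- exact: (transition_iso J1p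
    (pullback_jacobian (mul_jacobian f1 p) (mul_jacobian f2 p) isop)).
- exact: esym (transitionE _ J1p).
apply/nbhs_ballP; exists r => //= x px.
apply/rowP => j; rewrite !mxE.
by have := gcst j x px; rewrite /g => <-; rewrite addrC subrK.
Qed.

End TransitionMatrix.


(** * Charts in cylindrical coordinates *)

Section TwiceDiff.
Context {R : realType}.

Lemma is_diff_mk3 (V : normedModType R) (f g h f' g' h' : V -> R) p :
  is_diff p f f' -> is_diff p g g' -> is_diff p h h' ->
  is_diff p (fun x => mk3 (f x) (g x) (h x)) (fun v => mk3 (f' v) (g' v) (h' v)).
Proof.
have E a b c : mk3 a b c = a *: mk3 1 0 0 + b *: mk3 0 1 0 + c *: mk3 0 0 1 :> vec3 R.
  by apply: vec3P; rewrite !coordE; ring.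
have Zl (k k' : V -> R) (e : vec3 R) : is_diff p k k' ->
    is_diff p (fun x => k x *: e) (fun v => k' v *: e).
  move=> [dk <-]; split; first exact: differentiableZl.
  exact: diffZl.
move=> df dg dh.
under eq_fun do rewrite E.
under [X in is_diff _ _ X]eq_fun do rewrite E.
exact: is_diffD (is_diffD (Zl _ _ _ df) (Zl _ _ _ dg)) (Zl _ _ _ dh).
Qed.

Lemma is_diff_cos (y : R) : is_diff y (@cos R) (fun h => h * - sin y).
Proof.
have [d e] := is_derive_cos y; have dc : differentiable (@cos R) y.
  exact/derivable1_diffP.
split => //; rewrite diff1E//; apply/funext => h.
by rewrite derive1E e.
Qed.

Lemma is_diff_sin (y : R) : is_diff y (@sin R) (fun h => h * cos y).
Proof.
have [d e] := is_derive_sin y; have dc : differentiable (@sin R) y.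
  exact/derivable1_diffP.
split => //; rewrite diff1E//; apply/funext => h.
by rewrite derive1E e.
Qed.

Lemma is_diff_coord_id i (p : vec3 R) : is_diff p (fun x => x 0 i) (fun v => v 0 i).
Proof.
have d : differentiable (id : vec3 R -> vec3 R) p by [].
by apply: is_diff_eq (is_diff_coord 0 i d) _; rewrite diff_val.
Qed.

Lemma sum_coord_linear (A : 'M[R]_3) (D : vec3 R -> vec3 R) :
  (forall w, w *m A = D w) -> forall v : vec3 R, \sum_i v 0 i *: D (delta_mx 0 i) = D v.
Proof.
by move=> E v; rewrite -E mulmx_sum_row; apply: eq_bigr => i _; rewrite -E rowE.
Qed.

Lemma Ck2_twice_diff (f : vec3 R -> vec3 R) V p :
  open V -> Ck 2 V f -> V p -> twice_diff f p.
Proof.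
move=> oV [df d2f] Vp.
have nV : \forall x \near p, V x by exact: open_nbhs_nbhs.
split; first by apply: filterS nV => x; exact: df.
move=> v.
have dsum (w : 'I_3 -> vec3 R -> vec3 R) : (forall i, differentiable (w i) p) ->
    differentiable (fun x => \sum_i v 0 i *: w i x) p.
  move=> dw; rewrite (_ : (fun x => _) = \sum_i v 0 i *: w i); last first.
    by apply/funext => x; rewrite fct_sumE.
  by apply: differentiable_sum => i; exact: differentiableZ.
have N : \forall x \near p,
    \sum_i v 0 i *: 'D_(delta_mx 0 i) f x = 'd f x v.
  apply: filterS nV => x Vx.
  apply: etrans (sum_coord_linear (mul_jacobian f x) v).
  by apply: eq_bigr => i _; congr (_ *: _); exact: deriveE (df x Vx).
exact: (near_eq_diff N (dsum _ (fun i => (d2f i).1 p Vp))).1.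
Qed.

Lemma differentiable_vec (V : normedModType R) (F : V -> vec3 R) p :
  (forall i, differentiable (fun x => F x 0 i) p) -> differentiable F p.
Proof.
move=> dF; have -> : F = fun x => mk3 (F x 0 0) (F x 0 1) (F x 0 2).
  by apply/funext => x; exact: mk3E.
have d i := differentiableP (dF i).
exact: (@ex_diff _ _ _ _ _ _ _ (is_diff_mk3 (d 0) (d 1) (d 2))).
Qed.

Lemma diff_sum_partial (f : vec3 R -> vec3 R) y (w : vec3 R) :
  'd f y w = \sum_i w 0 i *: 'd f y (delta_mx 0 i).
Proof. exact: esym (sum_coord_linear (mul_jacobian f y) w). Qed.

Lemma differentiable_scale (V : normedModType R) (k : V -> R) (F : V -> vec3 R) p :
  differentiable k p -> differentiable F p -> differentiable (fun x => k x *: F x) p.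
Proof.
move=> dk dF; apply: differentiable_vec => i.
under eq_fun do rewrite mxE.
exact: (differentiableM dk (@ex_diff _ _ _ _ _ _ _ (is_diff_coord 0 i dF))).
Qed.

Lemma twice_diff_comp (f g : vec3 R -> vec3 R) p :
  twice_diff g p -> twice_diff f (g p) -> twice_diff (f \o g) p.
Proof.
move=> [dg d2g] [df d2f].
have cg : {for p, continuous g}.
  exact: differentiable_continuous (nbhs_singleton dg).
have dfg : \forall x \near p, differentiable f (g x) by exact: (cg _ df).
split.
  near=> x; apply: differentiable_comp; [exact: (near dg x)|exact: (near dfg x)].
move=> v.
have N : \forall x \near p, \sum_i ('d g x v) 0 i *: 'd f (g x) (delta_mx 0 i) =
    'd (f \o g) x v.
  near=> x; have dgx : differentiable g x by exact: (near dg x).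
  have dfx : differentiable f (g x) by exact: (near dfg x).
  apply: etrans (esym (diff_sum_partial _ _ _)) _.
  exact: (congr1 (@^~ v) (esym (diff_comp dgx dfx))).
apply: (near_eq_diff N _).1.
rewrite (_ : (fun x => _) =
    \sum_i (fun x => ('d g x v) 0 i *: 'd f (g x) (delta_mx 0 i))); last first.
  by apply/funext => x; rewrite fct_sumE.
apply: differentiable_sum => i; apply: differentiable_scale.
  exact: (@ex_diff _ _ _ _ _ _ _ (is_diff_coord 0 i (d2g v))).
exact: (differentiable_comp (nbhs_singleton dg) (d2f _)).
Unshelve. all: by end_near. Qed.

End TwiceDiff.


(** * Developing maps of the models *)

Section Developing.
Context {R : realType}.
Implicit Types (al : R) (p q v : vec3 R).

Definition angle_ratio al : R := al / (2 * pi).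

(** The coordinates of q are read as (t, r, theta) with theta real. For a = 1 this is the passage
    from cylindrical to Cartesian coordinates; for a = [angle_ratio al] it unrolls the cone of angle
    al into Minkowski space. *)
Definition cyla (a : R) q : vec3 R := cyl (tc q) (xc q) (a * yc q).

Definition tcyl : vec3 R -> vec3 R := cyla 1.

(* In the null basis of [bil true] the developing map of the BTZ model is
   polynomial. *)
Definition dev al q : vec3 R :=
  if al == 0 then mk3 (tc q + xc q * yc q ^+ 2 / 2) (xc q) (xc q * yc q)
  else cyla (angle_ratio al) q.

Lemma pi2_neq0 : 2 * pi != 0 :> R.
Proof. by rewrite mulf_neq0 ?pnatr_eq0// gt_eqF// pi_gt0. Qed.

Definition dcyla (a : R) q v : vec3 R :=
  cyl_tangent (xc q) (a * yc q) (tc v) (xc v) (a * yc v).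

Lemma is_diff_mulc (V : normedModType R) (f f' : V -> R) (a : R) (p : V) :
  is_diff p f f' -> is_diff p (fun x => a * f x) (fun w => a * f' w).
Proof.
move=> df; apply: (is_diff_eq (is_diffM (is_diff_cst a p) df)).
by apply/funext => u; rewrite !fctE scaler0 addr0.
Qed.

Lemma is_diff_cosM (V : normedModType R) (f f' : V -> R) (p : V) :
  is_diff p f f' -> is_diff p (fun x => cos (f x)) (fun w => - sin (f p) * f' w).
Proof.
move=> df; apply: (is_diff_eq (is_diff_comp df (is_diff_cos (f p)))).
by apply/funext => u /=; rewrite mulrC.
Qed.

Lemma is_diff_sinM (V : normedModType R) (f f' : V -> R) (p : V) :
  is_diff p f f' -> is_diff p (fun x => sin (f x)) (fun w => cos (f p) * f' w).
Proof.
move=> df; apply: (is_diff_eq (is_diff_comp df (is_diff_sin (f p)))).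
by apply/funext => u /=; rewrite mulrC.
Qed.

Lemma is_diff_tc p : is_diff p (@tc R) (@tc R). Proof. exact: is_diff_coord_id. Qed.
Lemma is_diff_xc p : is_diff p (@xc R) (@xc R). Proof. exact: is_diff_coord_id. Qed.
Lemma is_diff_yc p : is_diff p (@yc R) (@yc R). Proof. exact: is_diff_coord_id. Qed.

Lemma is_diff_cyla a q : is_diff q (cyla a) (dcyla a q).
Proof.
have y := is_diff_mulc a (is_diff_yc q); have x := is_diff_xc q.
apply: is_diff_eq (is_diff_mk3 (is_diff_tc q)
  (is_diffM x (is_diff_cosM y)) (is_diffM x (is_diff_sinM y))) _.
apply/funext => v; rewrite /dcyla /cyl_tangent !fctE /GRing.scale /=.
by congr mk3; ring.
Qed.

Lemma twice_diff_cyla a q : twice_diff (cyla a) q.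
Proof.
split; first by near=> x; exact: (@ex_diff _ _ _ _ _ _ _ (is_diff_cyla a x)).
move=> v; rewrite (_ : (fun x => _) = fun x => dcyla a x v); last first.
  by apply/funext => x; rewrite (@diff_val _ _ _ _ _ _ _ (is_diff_cyla a x)).
have y := is_diff_mulc a (is_diff_yc q); have x := is_diff_xc q.
have c (k : R) : is_diff q (cst k) (fun=> 0) := is_diff_cst k q.
have s := is_diff_sinM y; have cs := is_diff_cosM y.
exact: (@ex_diff _ _ _ _ _ _ _ (is_diff_mk3 (c (tc v))
  (is_diffB (is_diffM (c (xc v)) cs) (is_diffM (is_diffM x s) (c (a * yc v))))
  (is_diffD (is_diffM (c (xc v)) s) (is_diffM (is_diffM x cs) (c (a * yc v)))))).
Unshelve. all: by end_near. Qed.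

Definition dev0 q : vec3 R :=
  mk3 (tc q + xc q * yc q ^+ 2 / 2) (xc q) (xc q * yc q).

Definition ddev0 q v : vec3 R :=
  mk3 (tc v + xc v * yc q ^+ 2 / 2 + xc q * yc q * yc v) (xc v)
      (xc v * yc q + xc q * yc v).

Lemma is_diff_dev0 q : is_diff q dev0 (ddev0 q).
Proof.
have y := is_diff_yc q; have x := is_diff_xc q; have t := is_diff_tc q.
have c (k : R) : is_diff q (cst k) (fun=> 0) := is_diff_cst k q.
apply: is_diff_eq (is_diff_mk3
  (is_diffD t (is_diffM (is_diffM x (is_diffM y y)) (c 2^-1))) x (is_diffM x y)) _.
apply/funext => v; rewrite /ddev0 !fctE /GRing.scale /=.
by congr mk3; field.
Qed.

Lemma twice_diff_dev0 q : twice_diff dev0 q.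
Proof.
split; first by near=> x; exact: (@ex_diff _ _ _ _ _ _ _ (is_diff_dev0 x)).
move=> v; rewrite (_ : (fun x => _) = fun x => ddev0 x v); last first.
  by apply/funext => x; rewrite (@diff_val _ _ _ _ _ _ _ (is_diff_dev0 x)).
have y := is_diff_yc q; have x := is_diff_xc q.
have c (k : R) : is_diff q (cst k) (fun=> 0) := is_diff_cst k q.
exact: (@ex_diff _ _ _ _ _ _ _ (is_diff_mk3
  (is_diffD (is_diffD (c (tc v))
     (is_diffM (is_diffM (c (xc v)) (is_diffM y y)) (c 2^-1)))
     (is_diffM (is_diffM x y) (c (yc v))))
  (c (xc v)) (is_diffD (is_diffM (c (xc v)) y) (is_diffM x (c (yc v)))))).
Unshelve. all: by end_near. Qed.

Definition ddev al q v : vec3 R :=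
  if al == 0 then ddev0 q v else dcyla (angle_ratio al) q v.

Lemma is_diff_dev al q : is_diff q (dev al) (ddev al q).
Proof.
rewrite /dev /ddev; case: (al == 0); [exact: is_diff_dev0|exact: is_diff_cyla].
Qed.

Lemma twice_diff_dev al q : twice_diff (dev al) q.
Proof.
rewrite /dev; case: (al == 0); [exact: twice_diff_dev0|exact: twice_diff_cyla].
Qed.

(** For al = 0 the terms in theta^2 dr^2 and r theta dr dtheta produced by the first coordinate of
    [dev] cancel those produced by the third. *)
Lemma metric_dev al q v : al != 2 * pi -> 0 < xc q ->
  metric al (tcyl q) (dcyla 1 q v) = bil (al == 0) (ddev al q v) (ddev al q v).
Proof.
move=> al2 r0; rewrite /tcyl /cyla /dcyla /ddev.
have [->|al0] := eqVneq al 0.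
  rewrite metric_cyl_BTZ// /bil /ddev0 !coordE; by field.
rewrite metric_cyl_massive// /bil /dcyla /cyl_tangent !coordE -/(angle_ratio al).
set a := angle_ratio al; set c := cos _; set s := sin _.
have : c ^+ 2 + s ^+ 2 = 1 by exact: cos2Dsin2.
move=> cs; transitivity (- (tc v * tc v) + (c ^+ 2 + s ^+ 2) * xc v ^+ 2 +
  a ^+ 2 * xc q ^+ 2 * (c ^+ 2 + s ^+ 2) * yc v ^+ 2); last by ring.
by rewrite cs; ring.
Qed.

Lemma det3E (A : 'M[R]_3) : \det A =
  A 0 0 * (A 1 1 * A 2 2 - A 1 2 * A 2 1) - A 0 1 * (A 1 0 * A 2 2 - A 1 2 * A 2 0)
  + A 0 2 * (A 1 0 * A 2 1 - A 1 1 * A 2 0).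
Proof.
pose a m n := A (inord m) (inord n).
have L i j : A i j = a (val i) (val j) by rewrite /a !inord_val.
rewrite (expand_det_row _ ord0) !big_ord_recl big_ord0 /cofactor.
rewrite !(expand_det_row _ ord0) !big_ord_recl !big_ord0 /cofactor !det_mx11.
rewrite !mxE !L /= /bump /= !addn0 !add1n !expr0 !expr1 !add0n /=.
by rewrite -[(-1) ^+ 2]/((-1) ^+ (1 + 1)) exprD expr1; ring.
Qed.

End Developing.


(** * Charts compared with developing maps *)

Section Charts.
Context {R : realType}.
Implicit Types (al : R) (p q v : vec3 R) (V : set (vec3 R)) (psi : vec3 R -> vec3 R).

(** Two booleans are carried because charts take values in the Minkowski form while [dev 0] uses the
    null basis, and because the types of the two models are compared only later. *)
Definition iso_form b1 b2 (M : 'M[R]_3) : Prop :=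
  [/\ forall u v, bil b2 (u *m M) (v *m M) = bil b1 u v, 0 < \det M &
      forall v, fut b1 v -> fut b2 (v *m M)].

Lemma eq_mulmx3 (A B : 'M[R]_3) : (forall v : vec3 R, v *m A = v *m B) -> A = B.
Proof. by move=> E; apply/row_matrixP => i; rewrite !rowE. Qed.

Lemma det_unit3 (A : 'M[R]_3) : \det A != 0 -> A \in unitmx.
Proof. by move=> A0; rewrite unitmxE unitfE. Qed.

Lemma iso_form_comp b1 b2 b3 M N :
  iso_form b1 b2 M -> iso_form b2 b3 N -> iso_form b1 b3 (M *m N).
Proof.
move=> [iM dM fM] [iN dN fN]; split.
- by move=> u v; rewrite !mulmxA iN iM.
- by rewrite det_mulmx mulr_gt0.
- by move=> v fv; rewrite mulmxA; apply/fN/fM.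
Qed.

Lemma iso_form_inv b1 b2 M : iso_form b1 b2 M -> iso_form b2 b1 (invmx M).
Proof.
move=> [iM dM fM]; have uM := det_unit3 (lt0r_neq0 dM).
have iI u v : bil b1 (u *m invmx M) (v *m invmx M) = bil b2 u v.
  by rewrite -iM !mulmxKV.
split => //; first by rewrite det_inv invr_gt0.
move=> v [v0 tv]; have w0 : bil b1 (v *m invmx M) (v *m invmx M) <= 0 by rewrite iI.
split => //; case: ltgtP => // tw; last first.
  have := causal_tc0 w0 (esym tw) => /(congr1 (mulmx^~ M)).
  by rewrite mulmxKV// mul0mx => v00; rewrite v00 tc0 ltxx in tv.
(* If the preimage of v pointed to the past, its opposite would be future, and M would send it to
   the past vector - v. *)
have [_] : fut b2 ((- (v *m invmx M)) *m M).
  apply: fM; split; last by rewrite tcN oppr_gt0.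
  by rewrite bilNl bilC bilNl opprK.
by rewrite mulNmx mulmxKV// tcN oppr_gt0 ltNge ltW.
Qed.

Lemma isom_E12_form (g : vec3 R -> vec3 R) : isom_E12 g ->
  exists A b, iso_form false false A /\ forall x, g x = x *m A + b.
Proof.
move=> [A [b [gE iA dA fA]]]; exists A, b; split => //; split => //.
  by apply: bil_polar => v; rewrite -!mink_bil.
Qed.

Lemma det_jacobian_cyla a q : \det (jacobian (cyla a) q) = a * xc q.
Proof.
have D v : v *m jacobian (cyla a) q = dcyla a q v.
  by rewrite mul_jacobian (@diff_val _ _ _ _ _ _ _ (is_diff_cyla a q)).
have E i j : jacobian (cyla a) q i j = dcyla a q (delta_mx 0 i) 0 j.
  by rewrite -D -rowE [RHS]mxE.
rewrite det3E !E /dcyla /cyl_tangent /tc /xc /yc !mxE /=.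
have cs : cos (a * q 0 2) ^+ 2 + sin (a * q 0 2) ^+ 2 = 1 :> R by exact: cos2Dsin2.
rewrite -[RHS]mulr1 -[in RHS]cs; ring.
Qed.

Lemma det_jacobian_dev0 q : \det (jacobian dev0 q) = xc q.
Proof.
have D v : v *m jacobian dev0 q = ddev0 q v.
  by rewrite mul_jacobian (@diff_val _ _ _ _ _ _ _ (is_diff_dev0 q)).
have E i j : jacobian dev0 q i j = ddev0 q (delta_mx 0 i) 0 j.
  by rewrite -D -rowE [RHS]mxE.
rewrite det3E !E /ddev0 /tc /xc /yc !mxE /=.
ring.
Qed.

Lemma angle_ratio_gt0 al : 0 <= al -> al != 0 -> 0 < angle_ratio al.
Proof.
by move=> a0 an; rewrite divr_gt0 ?mulr_gt0 ?pi_gt0// lt_def an.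
Qed.

Lemma det_jacobian_dev_gt0 al q : 0 <= al -> 0 < xc q ->
  0 < \det (jacobian (dev al) q).
Proof.
move=> a0 q0; have [al0|al0] := eqVneq al 0.
  rewrite (_ : dev al = dev0); first by rewrite det_jacobian_dev0.
  by apply/funext => x; rewrite /dev al0 eqxx.
rewrite (_ : dev al = cyla (angle_ratio al)).
  by rewrite det_jacobian_cyla mulr_gt0// angle_ratio_gt0.
by apply/funext => x; rewrite /dev (negbTE al0).
Qed.

Lemma diff_comp_is (U V W : normedModType R) (f : V -> W) (g dg : U -> V)
    (p v : U) : is_diff p g dg -> differentiable f (g p) ->
  'd (f \o g) p v = 'd f (g p) (dg v).
Proof. by move=> [d <-] df; rewrite diff_comp. Qed.

Lemma jacobian_comp (f g : vec3 R -> vec3 R) p :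
  differentiable g p -> differentiable f (g p) ->
  jacobian (f \o g) p = jacobian g p *m jacobian f (g p).
Proof.
move=> dg df; apply: eq_mulmx3 => v; rewrite mulmxA.
apply: etrans (mul_jacobian _ _ _) _.
apply: etrans (congr1 (@^~ v) (diff_comp dg df)) _.
apply: etrans (esym (mul_jacobian _ _ _)) _.
congr (_ *m _); exact: esym (mul_jacobian _ _ _).
Qed.

Lemma radius_tcyl q : 0 <= xc q -> Defs.radius (tcyl q) = xc q.
Proof. exact: radius_cyl. Qed.

(** Only the BTZ model has content. With (A, B, C) the components of v, causality reads B^2 + (r
    C)^2 <= 2 A B. A negative B contradicts this through the square of B theta + r C, a positive B
    makes A positive, and B = 0 forces C = 0, where [ddev0] leaves A unchanged. *)
Lemma ddev_future al q v : 0 < xc q -> fut (al == 0) (ddev al q v) -> 0 < tc v.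
Proof.
move=> r0; rewrite /ddev; have [_|_] := eqVneq al 0; last first.
  by move=> [_]; rewrite /dcyla /cyl_tangent !coordE.
move=> [H T]; move: H T; rewrite /bil /ddev0 !coordE.
set A := tc v; set B := xc v; set C := yc v; set r := xc q; set th := yc q.
move=> H T.
have H' : B ^+ 2 + (r * C) ^+ 2 <= 2 * B * A by move: H; nra.
have [B0|B0|B0] := ltgtP B 0.
- have : B * (A + B * th ^+ 2 / 2 + r * th * C) < 0 by rewrite nmulr_rlt0.
  have := sqr_ge0 (B * th + r * C); have := sqr_ge0 B; nra.
- have : 0 < 2 * B * A.
    apply: lt_le_trans H'; apply: ltr_pwDl; first by rewrite exprn_gt0.
    exact: sqr_ge0.
  by rewrite pmulr_rgt0// mulr_gt0.
- move: H'; rewrite B0 mulr0 mul0r expr0n /= add0r.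
  move=> h; have : r * C = 0 by apply/eqP; rewrite -sqrf_eq0 eq_le h sqr_ge0.
  move=> /eqP; rewrite mulf_eq0 (gt_eqF r0) /= => /eqP C0.
  by move: T; rewrite B0 C0 !mul0r mulr0 !addr0.
Qed.

Lemma near_xc_gt0 q : 0 < xc q -> \forall x \near q, 0 < xc x.
Proof.
move=> q0; have c : {for q, continuous (@xc R)} by exact: coord_continuous.
exact: (c _ (lt_nbhsr q0)).
Qed.

Lemma continuous_tcyl q : {for q, continuous tcyl}.
Proof. exact/differentiable_continuous/(@ex_diff _ _ _ _ _ _ _ (is_diff_cyla 1 q)). Qed.

(** Rigidity is applied to [dev al] and [psi \o tcyl]. The sign of det M follows from the positive
    Jacobians of both maps, and its time order from [ddev_future], which brings a future vector back
    to the model, where psi preserves the future. *)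
Lemma chart_cylindrical al V psi q : 0 <= al -> al != 2 * pi ->
  is_chart al V psi -> 0 < xc q -> V (tcyl q) ->
  exists M c, iso_form (al == 0) false M /\
    \forall x \near q, psi (tcyl x) = dev al x *m M + c.
Proof.
move=> al0 al2 [[oV _] _ Cpsi Jpsi dpsi] q0 Vq.
have nV : \forall x \near q, 0 < xc x /\ V (tcyl x).
  near=> x; split; near: x; first exact: near_xc_gt0.
  exact: (continuous_tcyl (open_nbhs_nbhs (conj oV Vq))).
have dT (x : vec3 R) : is_diff x tcyl (dcyla 1 x) := is_diff_cyla 1 x.
have ddf x : V (tcyl x) -> differentiable psi (tcyl x).
  by move=> Vx; have [] := Ck2_twice_diff oV (Cpsi 2) Vx => /nbhs_singleton.
have Jc x : V (tcyl x) -> jacobian (psi \o tcyl) x =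
    jacobian tcyl x *m jacobian psi (tcyl x).
  move=> Vx; apply: jacobian_comp; last exact: ddf.
  exact: (@ex_diff _ _ _ _ _ _ _ (dT x)).
have Jc0 x : 0 < xc x -> V (tcyl x) -> 0 < \det (jacobian (psi \o tcyl) x).
  move=> x0 Vx; rewrite Jc// det_mulmx mulr_gt0 ?Jpsi//.
  by rewrite det_jacobian_cyla mul1r.
have dc x v : V (tcyl x) -> 'd (psi \o tcyl) x v = 'd psi (tcyl x) (dcyla 1 x v).
  by move=> Vx; exact: diff_comp_is (dT x) (ddf _ Vx).
have dd x v : 'd (dev al) x v = ddev al x v.
  by rewrite (@diff_val _ _ _ _ _ _ _ (is_diff_dev al x)).
have [|M [c [iM JM near_eq]]] := @flat_rigidity R (al == 0) false (dev al)
  (psi \o tcyl) q; last first.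
  exists M, c; split => //; split => //.
    have := Jc0 _ q0 Vq; rewrite JM det_mulmx pmulr_rgt0//.
    exact: det_jacobian_dev_gt0.
  move=> v fv; have J0 := lt0r_neq0 (det_jacobian_dev_gt0 al0 q0).
  have vE : v = ddev al q (v *m invmx (jacobian (dev al) q)).
    by rewrite -dd -mul_jacobian mulmxKV// det_unit3.
  move: vE; set w := v *m _ => vE.
  have vM : v *m M = 'd psi (tcyl q) (dcyla 1 q w).
    apply: etrans (dc _ _ Vq); apply: etrans (mul_jacobian _ _ _).
    rewrite JM mulmxA; congr (_ *m _).
    by apply: etrans vE _; rewrite -dd; exact: esym (mul_jacobian _ _ _).
  rewrite vM; apply: (dpsi _ Vq).2; split.
    by rewrite metric_dev// -vE; exact: fv.1.
  by rewrite /dcyla /cyl_tangent tc_mk3; apply: (@ddev_future al q); rewrite -?vE.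
near=> x.
have [x0 Vx] : 0 < xc x /\ V (tcyl x) by near: x.
split.
- exact: twice_diff_dev.
- exact: twice_diff_comp (twice_diff_cyla 1 x) (Ck2_twice_diff oV (Cpsi 2) Vx).
- exact/lt0r_neq0/det_jacobian_dev_gt0.
- exact/lt0r_neq0/Jc0.
move=> v; apply: etrans (congr1 (fun z : vec3 R => bil false z z) (dc x v Vx)) _.
apply: etrans (etrans (esym (mink_bil _)) ((dpsi _ Vx).1 _)) _.
apply: etrans (metric_dev v al2 x0) _.
by rewrite dd.
Unshelve. all: by end_near. Qed.

(** Charts are compared with each other directly, which includes the charts of Minkowski space,
    outside the scope of [chart_cylindrical]. *)
Lemma chart_transition al V1 psi1 V2 psi2 p :
  is_chart al V1 psi1 -> is_chart al V2 psi2 -> V1 p -> V2 p ->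
  exists M c, M \in unitmx /\ \forall x \near p, psi2 x = psi1 x *m M + c.
Proof.
move=> [[oV1 _] _ C1 J1 d1] [[oV2 _] _ C2 J2 d2] V1p V2p.
have [|M [c [_ JM E]]] := @flat_rigidity R false false psi1 psi2 p.
  near=> x.
  have V1x : V1 x by near: x; exact: open_nbhs_nbhs.
  have V2x : V2 x by near: x; exact: open_nbhs_nbhs.
  split; [exact: Ck2_twice_diff oV1 (C1 2) V1x|exact: Ck2_twice_diff oV2 (C2 2) V2x
    |exact/lt0r_neq0/J1|exact/lt0r_neq0/J2|].
  move=> v; apply: etrans (esym (mink_bil _)) _; apply: etrans ((d2 _ V2x).1 v) _.
  exact: etrans (esym ((d1 _ V1x).1 v)) (mink_bil _).
exists M, c; split => //; apply: det_unit3.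
have := J2 _ V2p; rewrite JM det_mulmx pmulr_rgt0; last exact: J1.
exact: lt0r_neq0.
Unshelve. all: by end_near. Qed.

End Charts.


(** * Angles and lifts to cylindrical coordinates *)

Section Angles.
Context {R : realType}.
Implicit Types (x y c s : R).

Lemma circle_angle c s : c ^+ 2 + s ^+ 2 = 1 -> exists x, cos x = c /\ sin x = s.
Proof.
move=> cs.
have c1 : -1 <= c <= 1.
  rewrite -ler_norml -(@expr_le1 _ 2)// -normrX ger0_norm ?sqr_ge0//.
  by have := sqr_ge0 s; lra.
have cx : cos (acos c) = c by rewrite acosK// in_itv.
have sx : sin (acos c) = `|s|.
  by rewrite sin_acos// -cs addrAC subrr add0r sqrtr_sqr.
have [s0|s0] := leP 0 s.
  by exists (acos c); rewrite cx sx ger0_norm.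
by exists (- acos c); rewrite cosN sinN cx sx ltr0_norm// opprK.
Qed.

Lemma cosD2pin x (n : nat) : cos (x + 2 * pi * n%:R) = cos x /\ sin (x + 2 * pi * n%:R) = sin x.
Proof.
elim: n => [|n [IHc IHs]]; first by rewrite mulr0 addr0.
have E : x + 2 * pi * n.+1%:R = x + 2 * pi * n%:R + pi *+ 2.
  by rewrite -natr1 -[pi *+ 2]mulr_natl; ring.
by rewrite E cosD2pi sinD2pi.
Qed.

Lemma cosD2piz x (n : int) : cos (x + 2 * pi * n%:~R) = cos x /\ sin (x + 2 * pi * n%:~R) = sin x.
Proof.
case: (intP n) => [|{}n|{}n]; first by rewrite mulr0 addr0.
  exact: cosD2pin.
have [<- <-] := cosD2pin (x + 2 * pi * (- n.+1%:Z)%:~R) n.+1.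
suff -> : x + 2 * pi * (- n.+1%:Z)%:~R + 2 * pi * n.+1%:R = x by [].
by rewrite mulrNz -pmulrn; ring.
Qed.

Lemma cos_eq1 x : cos x = 1 -> exists n : int, x = 2 * pi * n%:~R.
Proof.
move=> cx; have p2 : 0 < 2 * pi :> R by rewrite mulr_gt0// pi_gt0.
pose n := Num.floor (x / (2 * pi)); exists n.
have : 0 <= x - 2 * pi * n%:~R.
  by rewrite subr_ge0 mulrC -ler_pdivlMr// floor_le.
have : x - 2 * pi * n%:~R < 2 * pi.
  rewrite ltrBlDr -{1}[2 * pi]mulr1 -mulrDr mulrC -ltr_pdivrMr//.
  by rewrite addrC -(intrD _ n 1) floorD1_gt.
have : cos (x - 2 * pi * n%:~R) = 1.
  by rewrite -mulrN -mulrNz; have [-> _] := cosD2piz x (- n).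
set y := x - _ => cy y2 y0.
suff y00 : y = 0 by apply/eqP; rewrite -subr_eq0; apply/eqP.
have [yp|yp] := leP y pi.
  by apply: cos_inj; rewrite ?in_itv /= ?y0 ?lexx ?pi_ge0// cy cos0.
exfalso; have : 2 * pi - y = 0; last by lra.
apply: cos_inj; rewrite ?in_itv /= ?lexx ?pi_ge0//; first by apply/andP; split; lra.
rewrite cos0; transitivity (cos (y - 2 * pi)); first by rewrite -cosN opprB.
by have [<- _] := cosD2piz (y - 2 * pi) 1; rewrite mulr1 subrK.
Qed.

Lemma angle_eq_mod x y : cos x = cos y -> sin x = sin y ->
  exists n : int, y = x + 2 * pi * n%:~R.
Proof.
move=> cE sE; have [|n nE] := @cos_eq1 (y - x).
  by rewrite cosB cE sE -!expr2 cos2Dsin2.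
by exists n; rewrite -nE addrC subrK.
Qed.

Lemma angle_eq_near x y : cos x = cos y -> sin x = sin y ->
  `|y - x| < 2 * pi -> y = x.
Proof.
move=> cE sE; have [n ->] := angle_eq_mod cE sE.
rewrite [x + _]addrC addrK normrM ger0_norm ?mulr_ge0 ?pi_ge0//.
rewrite -{2}[2 * pi]mulr1 ltr_pM2l ?mulr_gt0 ?pi_gt0//.
rewrite -intr_norm -[1]/(1%:~R) ltr_int => n0.
have -> : n = 0 by apply/eqP; rewrite -normr_le0 -ltzD1.
by rewrite mulr0 add0r.
Qed.

(** The map theta -> a theta of the circle is well defined by the first condition, so a is an
    integer, and injective by the second, which at x = 2 pi / a makes 1 / a an integer. *)
Lemma winding_one (a : R) : 0 < a -> cos (a * (2 * pi)) = 1 ->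
  (forall x, cos (a * x) = 1 -> cos x = 1) -> a = 1.
Proof.
move=> a0 /cos_eq1[n nE] inj.
have p0 : 2 * pi != 0 :> R by exact: pi2_neq0.
have an : a = n%:~R.
  by apply: (mulIf p0); rewrite nE mulrC.
have /inj/cos_eq1[m mE] : cos (a * (2 * pi / a)) = 1.
  have [c1 _] := cosD2piz 0 1; rewrite add0r mulr1 in c1.
  apply: etrans (etrans c1 (cos0 R)); congr cos; by field; rewrite lt0r_neq0.
have nm : a * m%:~R = 1.
  apply: (mulfI p0); transitivity (a * (2 * pi * m%:~R)); first by ring.
  by rewrite -mE; field; rewrite lt0r_neq0.
have n0 : (0 < n)%R by rewrite -(ltr_int R) -an.
have /eqP : (n * m)%R = 1 by apply/eqP; rewrite -(eqr_int R) intrM -an nm.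
rewrite an; case: n n0 {nE an nm} => [[|[|n]]|n]// _.
by move=> /eqP/(congr1 absz)/eqP; rewrite abszM muln_eq1.
Qed.

End Angles.

Section Lifts.
Context {R : realType}.
Implicit Types (p q : vec3 R) (N : set (vec3 R)).

Lemma tcylE q : tcyl q = mk3 (tc q) (xc q * cos (yc q)) (xc q * sin (yc q)).
Proof. by rewrite /tcyl /cyla mul1r. Qed.

Lemma radius_ge0 p : 0 <= Defs.radius p. Proof. exact: sqrtr_ge0. Qed.

Lemma radius_sqr p : Defs.radius p ^+ 2 = xc p ^+ 2 + yc p ^+ 2.
Proof. by rewrite sqr_sqrtr// addr_ge0// sqr_ge0. Qed.

Lemma radius_eq0 p : Defs.radius p = 0 -> p = mk3 (tc p) 0 0.
Proof.
move=> p0; move/eqP: (radius_sqr p); rewrite p0 expr0n eq_sym.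
rewrite paddr_eq0 ?sqr_ge0// !sqrf_eq0 => /andP[/eqP x0 /eqP y0].
by apply: vec3P; rewrite !coordE.
Qed.

Lemma tcyl_surj p : exists q, [/\ tc q = tc p, xc q = Defs.radius p & tcyl q = p].
Proof.
have [r0|r0] := eqVneq (Defs.radius p) 0.
  exists (mk3 (tc p) 0 0); rewrite tcylE !coordE r0 !mul0r; split => //.
  by rewrite [RHS](radius_eq0 r0).
have [|th [c s]] := @circle_angle R (xc p / Defs.radius p) (yc p / Defs.radius p).
  by rewrite !expr_div_n -mulrDl -radius_sqr divff// expf_neq0.
exists (mk3 (tc p) (Defs.radius p) th); rewrite tcylE !coordE; split => //.
by apply: vec3P; rewrite !coordE// ?c ?s mulrC divfK.
Qed.

Lemma tcyl_eq q q' : 0 < xc q -> 0 < xc q' -> tcyl q = tcyl q' ->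
  [/\ tc q = tc q', xc q = xc q', cos (yc q) = cos (yc q') &
      sin (yc q) = sin (yc q')].
Proof.
move=> q0 q0' E.
have xE : xc q = xc q' by rewrite -(radius_tcyl (ltW q0)) E (radius_tcyl (ltW q0')).
move: E; rewrite !tcylE => E.
have tE := congr1 tc E; have cE := congr1 xc E; have sE := congr1 yc E.
move: tE cE sE; rewrite !coordE xE => -> /(mulfI (lt0r_neq0 q0')) ->.
by move=> /(mulfI (lt0r_neq0 q0')) ->.
Qed.

Definition turn (d : R) q : vec3 R := mk3 (tc q) (xc q) (yc q + d).

Lemma tcyl_eq_turn q q' : 0 < xc q -> 0 < xc q' -> tcyl q = tcyl q' ->
  exists n : int, q' = turn (2 * pi * n%:~R) q.
Proof.
move=> q0 q0' /tcyl_eq[]// tE xE cE sE.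
have [n nE] := angle_eq_mod cE sE; exists n.
by apply: vec3P; rewrite !coordE.
Qed.

Lemma tcyl_turn (n : int) q : tcyl (turn (2 * pi * n%:~R) q) = tcyl q.
Proof. by rewrite !tcylE !coordE; have [-> ->] := cosD2piz (yc q) n. Qed.

Lemma tcyl_inj_near q q' : 0 < xc q -> 0 < xc q' -> tcyl q = tcyl q' ->
  `|yc q' - yc q| < 2 * pi -> q = q'.
Proof.
move=> q0 q0' /tcyl_eq[]// tE xE cE sE h.
by apply: vec3P => //; apply/esym/angle_eq_near.
Qed.

Lemma cvg_mk3 (T : Type) (F : set_system T) {FF : Filter F} (f g h : T -> R) a b c :
  f @ F --> a -> g @ F --> b -> h @ F --> c ->
  (fun x => mk3 (f x) (g x) (h x)) @ F --> mk3 a b c.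
Proof.
have E x y z : mk3 x y z = x *: mk3 1 0 0 + y *: mk3 0 1 0 + z *: mk3 0 0 1 :> vec3 R.
  by apply: vec3P; rewrite !coordE; ring.
move=> fa gb hc; rewrite E; under eq_fun do rewrite E.
by apply: cvgD; [apply: cvgD|]; apply: cvgZr_tmp.
Qed.

Lemma continuous_radius p : {for p, continuous (@Defs.radius R)}.
Proof.
apply: continuous_comp; last exact: sqrt_continuous.
by apply: continuousD; apply: (@continuous_comp _ _ _ _ (fun y : R => y ^+ 2));
  [exact: coord_continuous|exact: exprn_continuous
  |exact: coord_continuous|exact: exprn_continuous].
Qed.

(** An explicit continuous local inverse [loc] is used: u and w are the coordinates in the frame
    turned by the angle of q, and near [tcyl q], where u > 0, the angle is recovered as that of q
    plus atan (w / u). *)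
Lemma tcyl_open q N : 0 < xc q -> nbhs q N ->
  \forall p \near tcyl q, exists2 q', N q' & tcyl q' = p.
Proof.
move=> q0 qN; set c := cos (yc q); set s := sin (yc q).
pose u p := xc p * c + yc p * s; pose w p := yc p * c - xc p * s.
pose loc p := mk3 (tc p) (Defs.radius p) (yc q + atan (w p / u p)).
have cs : c ^+ 2 + s ^+ 2 = 1 by exact: cos2Dsin2.
have uq : u (tcyl q) = xc q.
  by rewrite /u tcylE !coordE -mulrA -mulrA -mulrDr -!expr2 cs mulr1.
have wq : w (tcyl q) = 0 by rewrite /w tcylE !coordE -/c -/s; ring.
have locq : loc (tcyl q) = q.
  rewrite /loc wq mul0r atan0 addr0 radius_tcyl ?ltW//.
  by apply: vec3P; rewrite !coordE// tcylE !coordE.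
have cx : {for tcyl q, continuous (@xc R)} by exact: coord_continuous.
have cy : {for tcyl q, continuous (@yc R)} by exact: coord_continuous.
have ct : {for tcyl q, continuous (@tc R)} by exact: coord_continuous.
have cu : {for tcyl q, continuous u}.
  by apply: continuousD; apply: continuousM => //; exact: cst_continuous.
have cw : {for tcyl q, continuous w}.
  by apply: continuousB; apply: continuousM => //; exact: cst_continuous.
have ca0 : {for tcyl q, continuous (fun p => yc q + atan (w p / u p))}.
  apply: continuousD; first exact: cst_continuous.
  apply: (@continuous_comp _ _ _ (fun p => w p / u p)); last exact: continuous_atan.
  by apply: continuousM => //; apply: continuousV => //; rewrite uq lt0r_neq0.
have cl : loc @ tcyl q --> q.
  have := @cvg_mk3 _ (nbhs (tcyl q)) (nbhs_filter _) _ _ _ _ _ _ ct (@continuous_radius (tcyl q)) ca0.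
  by rewrite -[mk3 _ _ _]/(loc (tcyl q)) locq.
have uq0 : 0 < u (tcyl q) by rewrite uq.
near=> p; exists (loc p); first by near: p; exact: (cl _ qN).
have up : 0 < u p by near: p; exact: (cu _ (lt_nbhsr uq0)).
have Er : Defs.radius p ^+ 2 = u p ^+ 2 + w p ^+ 2.
  rewrite radius_sqr /u /w -[LHS]mulr1 -cs; ring.
have rp : 0 < Defs.radius p.
  rewrite lt_def radius_ge0 andbT -sqrf_eq0 Er gt_eqF//.
  by rewrite ltr_pwDl ?exprn_gt0 ?sqr_ge0.
have ca : cos (atan (w p / u p)) = u p / Defs.radius p.
  rewrite cos_atan (_ : 1 + _ = (Defs.radius p / u p) ^+ 2).
    by rewrite sqrtr_sqr ger0_norm ?divr_ge0 ?ltW// invf_div.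
  by rewrite !expr_div_n Er mulrDl divff// expf_neq0// lt0r_neq0.
have sa : sin (atan (w p / u p)) = w p / Defs.radius p.
  have cN : cos (atan (w p / u p)) != 0.
    by rewrite ca mulf_neq0 ?invr_eq0 ?lt0r_neq0.
  have := atanK (w p / u p); rewrite /tan => /(canRL (divfK cN)) ->.
  by rewrite ca; field; rewrite !lt0r_neq0.
rewrite tcylE !coordE cosD sinD -/c -/s ca sa.
apply: vec3P; rewrite !coordE//.
  rewrite [LHS](_ : _ = u p * c - w p * s); last by field; rewrite lt0r_neq0.
  by rewrite /u /w -[RHS]mulr1 -cs; ring.
rewrite [LHS](_ : _ = u p * s + w p * c); last by field; rewrite lt0r_neq0.
by rewrite /u /w -[RHS]mulr1 -cs; ring.
Unshelve. all: by end_near. Qed.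

End Lifts.


(** * Gluing along a connected set *)

Section Partition.

(** An index k is a candidate description valid at some points of Q. By the last condition two
    indices valid at a common point are valid at the same points of Q, so the validity sets
    partition Q; by the local condition they are open in Q, hence also closed. Indices may thus
    differ by a monodromy. *)
Lemma connected_constant_index (T : topologicalType) (Q : set T) (K : Type)
    (P : K -> T -> Prop) :
  connected Q -> open Q -> Q !=set0 ->
  (forall q, Q q -> exists k, \forall x \near q, P k x) ->
  (forall k k' q, Q q -> P k q -> P k' q -> forall x, Q x -> P k x -> P k' x) ->
  exists k, forall q, Q q -> P k q.
Proof.
move=> cQ oQ [q0 Qq0] loc glue; have [k0 /nbhs_singleton P0] := loc _ Qq0.
exists k0 => q Qq; suff : (Q `&` [set x | P k0 x]) q by case.
suff -> : Q `&` [set x | P k0 x] = Q by [].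
apply: cQ; first by exists q0.
- exists (interior [set x | P k0 x]); first exact: open_interior.
  apply/seteqP; split => x [Qx Px]; split => //; last exact: (interior_subset Px).
  have [k Pk] := loc _ Qx; have Pkx := nbhs_singleton Pk; rewrite /interior /=.
  have nQ : \forall y \near x, Q y by exact: open_nbhs_nbhs.
  apply: filterS2 nQ Pk => y Qy; exact: (glue k k0 x).
- exists (~` interior (~` [set x | P k0 x])).
    by rewrite closedC; exact: open_interior.
  apply/seteqP; split => x [Qx Px]; split => //.
    by move=> /interior_subset.
  apply: contrapT => nPx; apply: Px; rewrite /interior /=.
  have [k Pk] := loc _ Qx; have Pkx := nbhs_singleton Pk.
  have nQ : \forall y \near x, Q y by exact: open_nbhs_nbhs.
  apply: filterS2 nQ Pk => y Qy Pky Pk0; apply: nPx.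
  exact: (glue k k0 y).
Qed.

Lemma convex_connected (R : realType) (V : normedModType R) (A : set V) :
  (forall x y t, A x -> A y -> 0 <= t <= 1 -> A (x + t *: (y - x))) -> connected A.
Proof.
move=> cA; have [->|/set0P[x0 Ax0]] := eqVneq A set0; first exact: connected0.
have -> : A = \bigcup_(y in A) ((fun t : R => x0 + t *: (y - x0)) @` `[0, 1]).
  apply/seteqP; split => [y Ay|y [z Az] [t]].
    exists y => //; exists 1; first by rewrite /= in_itv /= ler01 lexx.
    by rewrite scale1r addrC subrK.
  by rewrite /= in_itv /= => t01 <-; exact: cA.
apply: bigcup_connected.
  exists x0 => y Ay; exists 0; first by rewrite /= in_itv /= ler01 lexx.
  by rewrite scale0r addr0.
move=> y Ay; apply: connected_continuous_connected; first exact: segment_connected.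
apply: continuous_subspaceT => t.
by apply: cvgD; [exact: cvg_cst|exact: scalel_continuous].
Qed.

End Partition.

(** * Local lifts of a morphism to the developing maps *)

Section LocalLifts.
Context {R : realType}.

Lemma is_diff_affine (N : 'M[R]_3) (b p : vec3 R) :
  is_diff p (fun x => x *m N + b) (fun v => v *m N).
Proof.
pose L : {linear vec3 R -> vec3 R} := mulmxr N.
have cL : continuous L.
  move=> x; apply: differentiable_continuous; apply: differentiable_vec => i.
  under eq_fun do rewrite /= row_mulmxE.
  apply: differentiable_bigsum => j _; apply: differentiableM => //.
  exact: differentiable_coord.
have dL : is_diff p L L.
  by split; [exact: linear_differentiable|exact: diff_lin].
by apply: is_diff_eq (is_diffD dL (is_diff_cst b p)) _; rewrite addr0.
Qed.

Implicit Types (al be : R) (p q : vec3 R) (N W : set (vec3 R)) (f : vec3 R -> vec3 R).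

Definition rows3 (r0 r1 r2 : vec3 R) : 'M[R]_3 := \matrix_(i < 3) [:: r0; r1; r2]`_i.

Lemma mul_rows3 v r0 r1 r2 :
  v *m rows3 r0 r1 r2 = tc v *: r0 + xc v *: r1 + yc v *: r2.
Proof.
by apply: vec3P; rewrite !coordE !mxE.
Qed.

(** The matrix S is a rotation about the axis in the massive models and a parabolic isometry fixing
    the null axis direction in the BTZ model; at d = 2 pi n these are the holonomies. *)
Lemma dev_turn al (d : R) : exists S, forall q, dev al (turn d q) = dev al q *m S.
Proof.
have [al0|al0] := eqVneq al 0.
  exists (rows3 (mk3 1 0 0) (mk3 (d ^+ 2 / 2) 1 d) (mk3 d 0 1)) => q.
  rewrite mul_rows3 /dev al0 eqxx /turn; apply: vec3P; rewrite !coordE; by field.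
exists (rows3 (mk3 1 0 0) (mk3 0 (cos (angle_ratio al * d)) (sin (angle_ratio al * d)))
  (mk3 0 (- sin (angle_ratio al * d)) (cos (angle_ratio al * d)))) => q.
rewrite mul_rows3 /dev (negbTE al0) /cyla /cyl /turn.
by apply: vec3P; rewrite !coordE ?mulrDr ?cosD ?sinD; ring.
Qed.

Lemma cylaE a q : cyla a q = tcyl (mk3 (tc q) (xc q) (a * yc q)).
Proof. by rewrite tcylE /cyla !coordE. Qed.

Lemma dev_inj_near al : 0 <= al -> exists2 d : R, 0 < d & forall q q', 0 < xc q ->
  0 < xc q' -> dev al q = dev al q' -> `|yc q' - yc q| < d -> q = q'.
Proof.
move=> a0; have [al0|al0] := eqVneq al 0.
  (* Any positive constant would do: [dev 0] is injective on the whole region r > 0. *)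
  exists 1 => // q q' q0 _; rewrite /dev al0 eqxx => E _.
  have tE := congr1 tc E; have xE := congr1 xc E; have yE := congr1 yc E.
  move: tE xE yE; rewrite !coordE => tE xE; rewrite -xE => /(mulfI (lt0r_neq0 q0)) yE.
  by apply: vec3P => //; move: tE; rewrite -xE -yE => /addIr.
have r0 := angle_ratio_gt0 a0 al0.
exists (2 * pi / angle_ratio al); first by rewrite divr_gt0// mulr_gt0// pi_gt0.
move=> q q' q0 q0'; rewrite /dev (negbTE al0) !cylaE ltr_pdivlMr// => E h.
have := tcyl_inj_near _ _ E; rewrite !coordE -mulrBr normrM (gtr0_norm r0) mulrC.
move=> /(_ q0 q0' h) {}E.
have tE := congr1 tc E; have xE := congr1 xc E; have yE := congr1 yc E.
move: tE xE yE; rewrite !coordE => tE xE /(mulfI (lt0r_neq0 r0)) yE.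
exact: vec3P.
Qed.

Lemma RegP al p : al != 2 * pi -> Reg al p <-> 0 < Defs.radius p.
Proof.
move=> al2; rewrite /Reg /Sing /=; split => [h|r0 [_ r]].
  by rewrite lt_def radius_ge0 andbT; apply/eqP => r; apply: h.
by rewrite r ltxx in r0.
Qed.

(* [f], lifted to cylindrical coordinates near [q] with value [q'] at [q], is
   the affine map (M, c) in the developing maps. *)
Definition dev_lift al be f (M : 'M[R]_3) (c : vec3 R) q q' :=
  forall N, nbhs q' N -> \forall x \near q,
    exists q1, [/\ N q1, 0 < xc q1, tcyl q1 = f (tcyl x) &
                   dev be q1 = dev al x *m M + c].

Lemma continuous_comp_tcyl f q : {for tcyl q, continuous f} ->
  {for q, continuous (f \o tcyl)}.
Proof. move=> cf; apply: continuous_comp; [exact: continuous_tcyl|exact: cf]. Qed.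

Lemma local_dev_lift al be W f q q' : 0 <= al -> al != 2 * pi ->
  0 <= be -> be != 2 * pi -> E12_morphism al be W f -> W (tcyl q) ->
  {for tcyl q, continuous f} -> 0 < xc q -> 0 < xc q' -> tcyl q' = f (tcyl q) ->
  exists M c, iso_form (al == 0) (be == 0) M /\ dev_lift al be f M c q q'.
Proof.
move=> al0 al2 be0 be2 [_ mor] Wq cf q0 q0' E.
have [V [psi [V' [psi' [g [[cV Vq] [cV' Vq'] giso conj]]]]]] := mor _ Wq.
rewrite -E in Vq'.
have [M1 [c1 [i1 e1]]] := chart_cylindrical al0 al2 cV q0 Vq.
have [M2 [c2 [i2 e2]]] := chart_cylindrical be0 be2 cV' q0' Vq'.
have [A [b [iA gE]]] := isom_E12_form giso.
have i2' := iso_form_inv i2.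
(* This solves psi' (f (tcyl x)) = g (psi (tcyl x)) for the developed lift, psi and psi' being
   affine in the developing maps through (M1, c1) and (M2, c2). *)
exists (M1 *m A *m invmx M2), ((c1 *m A + b - c2) *m invmx M2); split.
  exact: iso_form_comp (iso_form_comp i1 iA) i2'.
have uM2 : M2 \in unitmx by case: i2 => _ d _; exact/det_unit3/lt0r_neq0.
move=> N Nq'.
have nN : \forall x \near q',
    [/\ N x, 0 < xc x & psi' (tcyl x) = dev be x *m M2 + c2].
  by apply: filterS3 Nq' (near_xc_gt0 q0') e2 => x.
have := tcyl_open q0' nN; rewrite E => no'.
have no : \forall x \near q, exists2 q1, [/\ N q1, 0 < xc q1 &
    psi' (tcyl q1) = dev be q1 *m M2 + c2] & tcyl q1 = f (tcyl x).
  exact: (continuous_comp_tcyl cf no').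
have nc : \forall x \near q, V' (f (tcyl x)) /\ psi' (f (tcyl x)) = g (psi (tcyl x)).
  exact: (continuous_tcyl conj).
apply: filterS3 no nc e1 => x [q1 [Nq1 q10 e2x] tq1] [_ cx] e1x.
exists q1; split => //.
apply: (can_inj (mulmxK uM2)) => /=.
rewrite [RHS]mulmxDl mulmxKV// !mulmxA mulmxKV//.
apply: (addIr c2); rewrite -e2x tq1 cx gE e1x mulmxDl.
by rewrite !addrA subrK.
Qed.

(** The target is seen through a prescribed chart instead of its developing map, so no lift has to
    be chosen there and Minkowski space is a possible target. *)
Lemma local_chart_dev al be W f q V1 psi1 : 0 <= al -> al != 2 * pi ->
  E12_morphism al be W f -> W (tcyl q) ->
  {for tcyl q, continuous f} -> 0 < xc q -> is_chart be V1 psi1 ->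
  V1 (f (tcyl q)) ->
  exists M c, M \in unitmx /\
    \forall x \near q, psi1 (f (tcyl x)) = dev al x *m M + c.
Proof.
move=> al0 al2 [_ mor] Wq cf q0 cV1 V1q.
have [V [psi [V' [psi' [g [[cV Vq] [cV' Vq'] giso conj]]]]]] := mor _ Wq.
have [M1 [c1 [i1 e1]]] := chart_cylindrical al0 al2 cV q0 Vq.
have [M2 [c2 [u2 e2]]] := chart_transition cV' cV1 Vq' V1q.
have [A [b [iA gE]]] := isom_E12_form giso.
exists (M1 *m A *m M2), ((c1 *m A + b) *m M2 + c2); split.
  have := iso_form_comp i1 iA => -[_ d _].
  by rewrite unitmx_mul u2 andbT; exact/det_unit3/lt0r_neq0.
have no : \forall x \near q, psi1 (f (tcyl x)) = psi' (f (tcyl x)) *m M2 + c2.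
  exact: (continuous_comp_tcyl cf e2).
have nc : \forall x \near q, V' (f (tcyl x)) /\ psi' (f (tcyl x)) = g (psi (tcyl x)).
  exact: (continuous_tcyl conj).
apply: filterS3 no nc e1 => x /= -> [_ ->] e1x.
by rewrite gE e1x !mulmxDl !mulmxA !addrA.
Qed.

Lemma dev_affine_inj al q (M M' : 'M[R]_3) c c' : 0 <= al -> 0 < xc q ->
  (\forall x \near q, dev al x *m M + c = dev al x *m M' + c') ->
  M = M' /\ c = c'.
Proof.
move=> al0 q0 E.
have MM : M = M'.
  have J0 := det_unit3 (lt0r_neq0 (det_jacobian_dev_gt0 al0 q0)).
  have dg (N : 'M[R]_3) (k : vec3 R) : is_diff q (fun x => dev al x *m N + k) (fun v => ddev al q v *m N).
    exact: (is_diff_comp (is_diff_dev al q) (is_diff_affine N k (dev al q))).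
  have [_ h] := near_eq_diff E (@ex_diff _ _ _ _ _ _ _ (dg M c)).
  have {}h := etrans (esym (@diff_val _ _ _ _ _ _ _ (dg M' c')))
    (etrans h (@diff_val _ _ _ _ _ _ _ (dg M c))).
  have JE v : v *m jacobian (dev al) q = ddev al q v.
    by rewrite mul_jacobian (@diff_val _ _ _ _ _ _ _ (is_diff_dev al q)).
  apply: eq_mulmx3 => v; rewrite -(mulmxKV J0 v) JE.
  exact: esym (congr1 (@^~ _) h).
split => //; have := nbhs_singleton E; rewrite MM.
exact: addrI.
Qed.

End LocalLifts.


(** * The map on a cylinder around the axis *)

Section Cylinder.
Context {R : realType}.
Implicit Types (al be : R) (p q : vec3 R) (N W : set (vec3 R)) (f : vec3 R -> vec3 R).

(** The points are triples (t, r, theta) with theta unrestricted: a convex universal cover of a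
    solid cylinder minus its axis. *)
Definition cylinder (t0 e : R) : set (vec3 R) :=
  [set q | `|tc q - t0| < e /\ 0 < xc q < e].

Lemma cylinder_connected t0 e : connected (cylinder t0 e).
Proof.
apply: convex_connected => x y t [] + /andP[x0 xe] [] + /andP[y0 ye] /andP[s0 s1].
rewrite !ltr_norml => /andP[x1 x2] /andP[y1 y2].
rewrite /cylinder /= ltr_norml !coordE.
have [t1|t1] := ltP t 1; last first.
  have -> : t = 1 by apply/le_anti; rewrite s1 t1.
  by rewrite !mul1r ![_ + (_ - _)]addrC !subrK y0 ye y1 y2.
set u := 1 - t; have u0 : 0 < u by rewrite subr_gt0.
have E a b : a + t * (b - a) = u * a + t * b by rewrite /u; ring.
by rewrite !E; split; apply/andP; split; rewrite /u in u0 *; nra.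
Qed.

Lemma cylinder_open t0 e : open (cylinder t0 e).
Proof.
move=> q [h1 /andP[h2 h3]].
have ct : {for q, continuous (@tc R)} by exact: coord_continuous.
have cx : {for q, continuous (@xc R)} by exact: coord_continuous.
have n1 : \forall x \near q, `|tc x - t0| < e.
  have c : {for q, continuous (fun x => `|tc x - t0|)}.
    apply: continuous_comp; last exact: norm_continuous.
    by apply: continuousB => //; exact: cst_continuous.
  exact: (c _ (lt_nbhsl h1)).
have n2 : \forall x \near q, 0 < xc x by exact: (cx _ (lt_nbhsr h2)).
have n3 : \forall x \near q, xc x < e by exact: (cx _ (lt_nbhsl h3)).
by apply: filterS3 n1 n2 n3 => x ? ? ?; split => //; apply/andP.
Qed.

Lemma continuous_mk3 (T : topologicalType) (f g h : T -> R) x :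
  {for x, continuous f} -> {for x, continuous g} -> {for x, continuous h} ->
  {for x, continuous (fun y => mk3 (f y) (g y) (h y))}.
Proof. by move=> cf cg ch; exact: (cvg_mk3 cf cg ch). Qed.

Lemma continuous_turn d q : {for q, continuous (turn d)}.
Proof.
have c i : {for q, continuous (fun x : vec3 R => x 0 i)}.
  exact: coord_continuous.
apply: (continuous_mk3 (c 0) (c 1)).
by apply: continuousD; [exact: c|exact: cst_continuous].
Qed.

Lemma near_yc q (d : R) : 0 < d -> \forall x \near q, `|yc x - yc q| < d.
Proof.
move=> d0; have c : {for q, continuous (fun x => `|yc x - yc q|)}.
  apply: continuous_comp; last exact: norm_continuous.
  by apply: continuousB; [exact: coord_continuous|exact: cst_continuous].
by apply: (c _ (lt_nbhsl _)); rewrite subrr normr0.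
Qed.

Lemma dev_lift_center al be f M c q q' : 0 < xc q' -> tcyl q' = f (tcyl q) ->
  dev_lift al be f M c q q' -> dev be q' = dev al q *m M + c.
Proof.
move=> q0' E L; have p2 : 0 < 2 * pi :> R by rewrite mulr_gt0// pi_gt0.
have /nbhs_singleton[q1 [h q10 E1 <-]] := L _ (near_yc q' p2).
by rewrite (@tcyl_inj_near _ q' q1)// E E1.
Qed.

Lemma dev_lift_open al be f M c q q' : 0 < xc q' -> dev_lift al be f M c q q' ->
  (\forall x \near q, {for tcyl x, continuous f}) ->
  \forall x \near q, exists q1,
    [/\ 0 < xc q1, tcyl q1 = f (tcyl x) & dev_lift al be f M c x q1].
Proof.
(* Three angular errors below pi / 2 add up to less than 2 pi, the bound under which [tcyl_inj_near]
   identifies two lifts. *)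
move=> q0' L cf; have p0 : 0 < pi / 2 :> R by rewrite divr_gt0// pi_gt0.
have L1 := L _ (near_yc q' p0).
have {}cf := nbhs_interior cf; have L2 := nbhs_interior L1.
apply: filterS2 L2 cf => x L2 /nbhs_singleton cf.
have [q1 [q1y q10 E1 _]] := nbhs_singleton L2.
exists q1; split => // N Nq1.
have nN : \forall y \near q1, [/\ N y, 0 < xc y & `|yc y - yc q1| < pi / 2].
  by apply: filterS3 Nq1 (near_xc_gt0 q10) (near_yc q1 p0) => y.
have := tcyl_open q10 nN; rewrite E1 => no'.
have no : \forall y \near x, exists2 q2,
    [/\ N q2, 0 < xc q2 & `|yc q2 - yc q1| < pi / 2] & tcyl q2 = f (tcyl y).
  exact: (continuous_comp_tcyl cf no').
apply: filterS2 no L2 => y [q2 [Nq2 q20 q2y] E2] [q3 [q3y q30 E3 D3]].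
exists q2; split => //; rewrite (@tcyl_inj_near _ q2 q3)// ?E2 ?E3//.
by move: q3y q2y q1y; rewrite !ltr_norml => /andP[? ?] /andP[? ?] /andP[? ?];
  apply/andP; split; lra.
Qed.

(** The two values lie over the same point, so they differ by a turn of 2 pi n; this turn acts on
    [dev be] by S, and an affine map is determined by its values on the open image of [dev al]. *)
Lemma dev_lift_glue al be f M c M' c' q q' q'' : 0 <= al ->
  0 < xc q -> 0 < xc q' -> 0 < xc q'' ->
  tcyl q' = f (tcyl q) -> tcyl q'' = f (tcyl q) ->
  dev_lift al be f M c q q' -> dev_lift al be f M' c' q q'' ->
  exists (n : int) S, [/\ forall x, dev be (turn (2 * pi * n%:~R) x) = dev be x *m S,
    M' = M *m S & c' = c *m S].
Proof.
move=> al0 q0 q0' q0'' E E' L L'.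
have [n nE] := tcyl_eq_turn q0' q0'' (etrans E (esym E')).
have [S SE] := dev_turn be (2 * pi * n%:~R).
exists n, S.
have p0 : 0 < pi / 2 :> R by rewrite divr_gt0// pi_gt0.
have [|-> ->//] := @dev_affine_inj R al q M' (M *m S) c' (c *m S) al0 q0.
have L1 := L _ (near_yc q' p0); have L2 := L' _ (near_yc q'' p0).
apply: filterS2 L1 L2 => x [q1 [q1y q10 E1 D1]] [q2 [q2y q20 E2 D2]].
rewrite -D2 mulmxA -mulmxDl -D1 -SE; congr (dev be _); apply/esym.
apply: tcyl_inj_near => //; first by rewrite coordE.
  by rewrite tcyl_turn E1 E2.
move: q1y q2y; rewrite nE !coordE !ltr_norml => /andP[? ?] /andP[? ?].
by apply/andP; split; lra.
Qed.

Lemma dev_lift_turn al be f M c q q' (n : int) S :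
  (forall x, dev be (turn (2 * pi * n%:~R) x) = dev be x *m S) ->
  dev_lift al be f M c q q' ->
  dev_lift al be f (M *m S) (c *m S) q (turn (2 * pi * n%:~R) q').
Proof.
move=> SE L N /continuous_turn /L; apply: filterS => x [q1 [Nq1 q10 E1 D1]].
exists (turn (2 * pi * n%:~R) q1); split => //; first by rewrite coordE.
  by rewrite tcyl_turn.
by rewrite SE D1 mulmxDl mulmxA.
Qed.

End Cylinder.


(** * No punctured cylinder is mapped into a single chart *)

Section CylinderMap.
Context {R : realType}.
Variables (al be : R) (U : set (vec3 R)) (phi : vec3 R -> vec3 R) (t0 e : R).
Hypotheses (al0 : 0 <= al) (al2 : al != 2 * pi) (be0 : 0 <= be) (e0 : 0 < e).
Hypothesis UE : forall p, `|tc p - t0| < e -> Defs.radius p < e -> U p.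
Hypothesis phi_cont : forall p, U p -> {for p, continuous phi}.
Hypothesis phi_mor : E12_morphism al be (U `&` Reg al) phi.
Hypothesis phi_inj : {in U `&` Reg al &, injective phi}.
Implicit Types (p q : vec3 R).

Local Notation Q := (cylinder t0 e).

Lemma cyl_UReg q : Q q -> (U `&` Reg al) (tcyl q).
Proof.
move=> [h /andP[q0 qe]]; split; last first.
  by apply/RegP => //; rewrite radius_tcyl// ltW.
by apply: UE; [rewrite tcylE coordE|rewrite radius_tcyl// ltW].
Qed.

Lemma axis_U t : `|t - t0| < e -> U (mk3 t 0 0).
Proof.
move=> h; apply: UE; first by rewrite coordE.
by rewrite /Defs.radius !coordE expr0n addr0 sqrtr0.
Qed.

Lemma cyl_cont q : Q q -> {for tcyl q, continuous phi}.
Proof. by move=> /cyl_UReg[Uq _]; exact: phi_cont. Qed.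

Lemma cyl_near q : Q q -> \forall x \near q, Q x.
Proof. by move=> Qq; apply: open_nbhs_nbhs; split => //; exact: cylinder_open. Qed.

Lemma cyl_xc q : Q q -> 0 < xc q. Proof. by case=> _ /andP[]. Qed.

Lemma turn_cyl d q : Q q -> Q (turn d q).
Proof. by rewrite /cylinder /turn /= !coordE. Qed.

Lemma Q_nonempty t r th : `|t - t0| < e -> 0 < r < e -> Q (mk3 t r th).
Proof. by move=> h r0; rewrite /cylinder /= !coordE. Qed.

Definition qbase (th : R) : vec3 R := mk3 t0 (e / 2) th.

Lemma qbaseQ th : Q (qbase th).
Proof.
apply: Q_nonempty; first by rewrite subrr normr0.
by rewrite divr_gt0//= ltr_pdivrMr// ltr_pMr// ltr1n.
Qed.

Lemma phi_tcyl_inj q q' : Q q -> Q q' -> phi (tcyl q) = phi (tcyl q') ->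
  tcyl q = tcyl q'.
Proof.
by move=> Qq Qq' E; apply: phi_inj => //; rewrite inE; exact: cyl_UReg.
Qed.

Lemma cos_of_turn q d : 0 < xc q -> tcyl (turn d q) = tcyl q -> cos d = 1.
Proof.
move=> q0 /tcyl_eq[]//; first by rewrite coordE.
move=> _ _; rewrite !coordE => cE sE.
have -> : d = yc q + d - yc q by rewrite addrAC subrr add0r.
by rewrite cosB cE sE -!expr2 cos2Dsin2.
Qed.

(** Composed with the chart, phi becomes an honest function on the cylinder, equal to one affine
    image of [dev al]. Injectivity of phi and of the chart then shows that turning a point leaves
    [dev al] unchanged exactly when it leaves [tcyl] unchanged. *)
Lemma chart_image_absurd V1 psi1 : is_chart be V1 psi1 ->
  (forall q, Q q -> V1 (phi (tcyl q))) -> False.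
Proof.
move=> cV1 inV1.
have [||[M c] G] := @connected_constant_index _ Q ('M[R]_3 * vec3 R)
    (fun k q => k.1 \in unitmx /\
      \forall x \near q, psi1 (phi (tcyl x)) = dev al x *m k.1 + k.2)
    (@cylinder_connected _ _ _) (@cylinder_open _ _ _)
    (ex_intro _ (qbase 0) (qbaseQ 0)).
- move=> q Qq.
  have [M [c [uM E]]] := local_chart_dev al0 al2 phi_mor (cyl_UReg Qq)
    (cyl_cont Qq) (cyl_xc Qq) cV1 (inV1 _ Qq).
  exists (M, c) => /=; have := nbhs_interior E; apply: filterS => x E'.
  by split.
- move=> [M c] [M' c'] q Qq /= [uM E] [uM' E'] x Qx.
  have [|-> ->//] := @dev_affine_inj R al q M M' c c' al0 (cyl_xc Qq).
  by apply: filterS2 E E' => y <- <-.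
have uM : M \in unitmx by have [] := G _ (qbaseQ 0).
have {}G q : Q q -> psi1 (phi (tcyl q)) = dev al q *m M + c.
  by move=> /G[_ /nbhs_singleton].
have devE d q : Q q -> tcyl (turn d q) = tcyl q -> dev al (turn d q) = dev al q.
  move=> Qq E; have := G _ (turn_cyl d Qq); rewrite E G// => /addIr.
  by move=> /(can_inj (mulmxK uM)).
have devE' d q : Q q -> dev al (turn d q) = dev al q -> tcyl (turn d q) = tcyl q.
  move=> Qq E; apply: phi_tcyl_inj => //; first exact: turn_cyl.
  have [_ inj _ _ _] := cV1; apply: inj; rewrite ?inE.
  - exact/inV1/turn_cyl.
  - exact: inV1.
  - by rewrite !G ?E//; exact: turn_cyl.
have q0 := cyl_xc (qbaseQ 0).
have T1 : tcyl (turn (2 * pi) (qbase 0)) = tcyl (qbase 0).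
  by have := tcyl_turn 1 (qbase 0); rewrite mulr1.
have D1 := devE _ _ (qbaseQ 0) T1.
(* In the BTZ model the last coordinate of [dev], namely r theta, is not periodic. *)
have [a0|a0] := eqVneq al 0.
  move: D1; rewrite /dev a0 eqxx => /(congr1 yc); rewrite !coordE add0r mulr0.
  move=> /eqP; rewrite !mulf_eq0 (gt_eqF e0) invr_eq0 !pnatr_eq0 /=.
  by rewrite gt_eqF// pi_gt0.
have a_gt0 := angle_ratio_gt0 al0 a0.
have key d : cos (angle_ratio al * d) = 1 <-> dev al (turn d (qbase 0)) = dev al (qbase 0).
  rewrite /dev (negbTE a0) !cylaE /turn !coordE mulr0 add0r; split.
    move=> cd; have sd : sin (angle_ratio al * d) = 0.
      apply/eqP; rewrite -sqrf_eq0; apply/eqP.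
      by have := cos2Dsin2 (angle_ratio al * d); rewrite cd expr1n; lra.
    by rewrite !tcylE !coordE cd sd cos0 sin0.
  move=> /tcyl_eq[]; rewrite !coordE//; first by move: q0; rewrite coordE.
    by move: q0; rewrite coordE.
  by move=> _ _ ->; rewrite cos0.
have a1 : angle_ratio al = 1.
  apply: winding_one => //; first exact/key.
  by move=> x /key/(devE' _ _ (qbaseQ 0))/(cos_of_turn q0).
move: al2; rewrite -[al](divfK (@pi2_neq0 R)) -/(angle_ratio al) a1.
by rewrite mul1r eqxx.
Qed.

End CylinderMap.


(** * Linear isometries preserving the axis direction *)

Section IsoForms.
Context {R : realType}.
Implicit Types (M : 'M[R]_3).

(** The first row of M is the image of the axis direction (1, 0, 0), future for both forms, which
    gives the sign of M 0 0; its square is - 1 or 0 according to the boolean. *)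
Lemma iso_form_axis b b' M : iso_form b b' M -> M 0 1 = 0 -> M 0 2 = 0 ->
  0 < M 0 0 /\ b = b'.
Proof.
move=> [iM dM fM] M01 M02.
have l0 : 0 < M 0 0.
  have [|_] := fM (mk3 1 0 0).
    by rewrite /fut /bil !coordE; split => //; case: b {iM fM} => /=; lra.
  by rewrite !coordE; lra.
split => //; have := iM (mk3 1 0 0) (mk3 1 0 0).
rewrite /bil !coordE M01 M02; have := mulr_gt0 l0 l0.
by case: b {iM fM} => //; case: b' => //; lra.
Qed.

Lemma iso_form_rotation M : iso_form false false M -> M 0 1 = 0 -> M 0 2 = 0 ->
  exists k, M = rows3 (mk3 1 0 0) (mk3 0 (cos k) (sin k)) (mk3 0 (- sin k) (cos k)).
Proof.
move=> iM M01 M02; have [l0 _] := iso_form_axis iM M01 M02.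
have [iM' dM _] := iM.
have E00 := iM' (mk3 1 0 0) (mk3 1 0 0); have E01 := iM' (mk3 1 0 0) (mk3 0 1 0).
have E02 := iM' (mk3 1 0 0) (mk3 0 0 1); have E11 := iM' (mk3 0 1 0) (mk3 0 1 0).
have E12 := iM' (mk3 0 1 0) (mk3 0 0 1); have E22 := iM' (mk3 0 0 1) (mk3 0 0 1).
move: E00 E01 E02 E11 E12 E22 dM; rewrite /bil !coordE det3E M01 M02.
set a := M 0 0 in l0 *; set b10 := M 1 0; set b11 := M 1 1; set b12 := M 1 2.
set b20 := M 2 0; set b21 := M 2 1; set b22 := M 2 2.
move=> E00 E01 E02 E11 E12 E22 dM.
have a1 : a = 1 by nra.
have b10_0 : b10 = 0 by rewrite a1 in E01; lra.
have b20_0 : b20 = 0 by rewrite a1 in E02; lra.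
rewrite a1 b10_0 b20_0 in E11 E12 E22 dM.
have [|k [ck sk]] := @circle_angle R b11 b12; first by lra.
(* Lagrange's identity for the two orthonormal rows gives the square of this minor; the positive
   determinant selects the sign. *)
have D : b11 * b22 - b12 * b21 = 1.
  have sq : (b11 * b22 - b12 * b21) ^+ 2 = 1.
    have c1 : b11 * b11 + b12 * b12 = 1 by lra.
    have c2 : b21 * b21 + b22 * b22 = 1 by lra.
    have c3 : b11 * b21 + b12 * b22 = 0 by lra.
    transitivity ((b11 * b11 + b12 * b12) * (b21 * b21 + b22 * b22)
      - (b11 * b21 + b12 * b22) ^+ 2); first by ring.
    by rewrite c1 c2 c3; ring.
  by nra.
have b22E : b22 = b11.
  transitivity (b22 * (b11 * b11 + b12 * b12)); first by rewrite (_ : b11 * b11 + _ = 1); lra.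
  transitivity (b11 * (b11 * b22 - b12 * b21) + b12 * (b11 * b21 + b12 * b22)); first by ring.
  by rewrite D (_ : b11 * b21 + b12 * b22 = 0); lra.
have b21E : b21 = - b12.
  transitivity (b21 * (b11 * b11 + b12 * b12)); first by rewrite (_ : b11 * b11 + _ = 1); lra.
  transitivity (b11 * (b11 * b21 + b12 * b22) - b12 * (b11 * b22 - b12 * b21)); first by ring.
  by rewrite D (_ : b11 * b21 + b12 * b22 = 0); lra.
exists k; apply: eq_mulmx3 => v; rewrite mul_rows3.
by apply: vec3P; rewrite !coordE ?ck ?sk ?M01 ?M02 -/a -/b10 -/b11 -/b12 -/b20
  -/b21 -/b22 ?a1 ?b10_0 ?b20_0 ?b21E ?b22E; ring.
Qed.

(** This is the stabilizer of the null direction: l is a boost factor and m the parabolic parameter.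
    The first entry of the second row is forced by the square of that row being 1, and that of the
    third by its product with the second. *)
Lemma iso_form_parabolic M : iso_form true true M -> M 0 1 = 0 -> M 0 2 = 0 ->
  exists l m, 0 < l /\ M = rows3 (mk3 l 0 0)
    (mk3 (l * (l^-1 ^+ 2 + m ^+ 2 - 1) / 2) l^-1 m) (mk3 (l * m) 0 1).
Proof.
move=> iM M01 M02; have [l0 _] := iso_form_axis iM M01 M02.
have [iM' dM _] := iM.
have E01 := iM' (mk3 1 0 0) (mk3 0 1 0); have E02 := iM' (mk3 1 0 0) (mk3 0 0 1).
have E11 := iM' (mk3 0 1 0) (mk3 0 1 0); have E12 := iM' (mk3 0 1 0) (mk3 0 0 1).
have E22 := iM' (mk3 0 0 1) (mk3 0 0 1).
move: E01 E02 E11 E12 E22 dM; rewrite /bil !coordE det3E M01 M02.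
set a := M 0 0 in l0 *; set b10 := M 1 0; set b11 := M 1 1; set b12 := M 1 2.
set b20 := M 2 0; set b21 := M 2 1; set b22 := M 2 2.
move=> E01 E02 E11 E12 E22 dM.
have ab11 : a * b11 = 1 by lra.
have b11E : b11 = a^-1 by apply: (mulfI (lt0r_neq0 l0)); rewrite ab11 divff// lt0r_neq0.
have b21_0 : b21 = 0.
  by apply: (mulfI (lt0r_neq0 l0)); rewrite mulr0; lra.
rewrite b21_0 in E12 E22 dM.
have b22_0 : 0 < b22.
  have : 0 < (a * b11) * b22 by lra.
  by rewrite ab11 mul1r.
have b22E : b22 = 1 by nra.
rewrite b22E in E12.
have b20E : b20 = a * b12.
  transitivity (a * b11 * b20); first by rewrite ab11 mul1r.
  by rewrite -mulrA; congr (_ * _); lra.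
exists a, b12; split => //; apply: eq_mulmx3 => v; rewrite mul_rows3.
have b10E : b10 = a * (b11 ^+ 2 + b12 ^+ 2 - 1) / 2.
  transitivity (a * b11 * b10); first by rewrite ab11 mul1r.
  have -> : a * b11 * b10 = a * (b10 * b11) by ring.
  rewrite -mulrA; congr (_ * _); lra.
by apply: vec3P; rewrite !coordE ?M01 ?M02 -/a -/b10 -/b11 -/b12 -/b20 -/b21 -/b22
  ?b21_0 ?b22E ?b20E ?b10E -?b11E; ring.
Qed.

End IsoForms.


(** * The global lift and its limit on the axis *)

Section CylinderScrew.
Context {R : realType}.

Definition screw (d k : R) (p : vec3 R) : vec3 R :=
  mk3 (tc p + d) (xc p * cos k - yc p * sin k) (xc p * sin k + yc p * cos k).

Lemma screw_tcyl d k q : screw d k (tcyl q) = tcyl (mk3 (tc q + d) (xc q) (yc q + k)).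
Proof.
by rewrite /screw !tcylE !coordE; apply: vec3P; rewrite !coordE ?cosD ?sinD; ring.
Qed.

Lemma continuous_screw d k (p : vec3 R) : {for p, continuous (screw d k)}.
Proof.
have c i : {for p, continuous (fun x : vec3 R => x 0 i)}.
  exact: coord_continuous.
apply: continuous_mk3.
- by apply: continuousD; [exact: c|exact: cst_continuous].
- by apply: continuousB; apply: continuousM; [exact: c|exact: cst_continuous
    |exact: c|exact: cst_continuous].
- by apply: continuousD; apply: continuousM; [exact: c|exact: cst_continuous
    |exact: c|exact: cst_continuous].
Qed.

Lemma eq_at0 (F G : R -> R) (e : R) : 0 < e ->
  {for 0, continuous F} -> {for 0, continuous G} ->
  (forall r, 0 < r < e -> F r = G r) -> F 0 = G 0.
Proof.
move=> e0 cF cG FG.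
have cF' : F r @[r --> 0^'+] --> F 0 by exact: cvg_at_right_filter.
have cG' : G r @[r --> 0^'+] --> G 0 by exact: cvg_at_right_filter.
suff H : F r @[r --> 0^'+] --> G 0 by exact: (cvg_unique (@Rhausdorff R) cF' H).
apply: cvg_trans cG'; apply: near_eq_cvg; near=> r; apply/esym/FG/andP; split; near: r.
  exact: nbhs_right_gt.
exact: nbhs_right_lt.
Unshelve. all: by end_near. Qed.

Variables (al be : R) (U : set (vec3 R)) (phi : vec3 R -> vec3 R) (t0 e : R).
Hypotheses (al0 : 0 <= al) (al2 : al != 2 * pi) (be0 : 0 <= be) (e0 : 0 < e).
Hypothesis (be2 : be != 2 * pi).
Hypothesis UE : forall p, `|tc p - t0| < e -> Defs.radius p < e -> U p.
Hypothesis phi_cont : forall p, U p -> {for p, continuous phi}.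
Hypothesis phi_mor : E12_morphism al be (U `&` Reg al) phi.
Hypothesis phi_inj : {in U `&` Reg al &, injective phi}.
Hypothesis phi_axis : forall t, `|t - t0| < e -> Defs.radius (phi (mk3 t 0 0)) = 0.
Implicit Types (p q : vec3 R).

Local Notation Q := (cylinder t0 e).

Lemma phi_lift q : Q q -> exists2 q', 0 < xc q' & tcyl q' = phi (tcyl q).
Proof.
move=> Qq; have [q' [_ r' E]] := tcyl_surj (phi (tcyl q)).
exists q' => //; rewrite r'; apply/(RegP _ be2).
apply: phi_mor.1; exists (tcyl q) => //; exact: (cyl_UReg al2 UE).
Qed.

(** The value q' is quantified at each q separately: two pairs (M, c) valid at one point differ by a
    holonomy S, and turning the values q' turns every lift for the first pair into a lift for the
    second. This is the gluing condition of [connected_constant_index]. *)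
Lemma global_dev_lift : exists M c, iso_form (al == 0) (be == 0) M /\
  forall q, Q q -> exists q', [/\ 0 < xc q', tcyl q' = phi (tcyl q) &
    dev_lift al be phi M c q q'].
Proof.
have [||[M c] G] := @connected_constant_index _ Q ('M[R]_3 * vec3 R)
    (fun k q => iso_form (al == 0) (be == 0) k.1 /\
      exists q', [/\ 0 < xc q', tcyl q' = phi (tcyl q) &
        dev_lift al be phi k.1 k.2 q q'])
    (@cylinder_connected _ _ _) (@cylinder_open _ _ _)
    (ex_intro _ (qbase t0 e 0) (qbaseQ t0 e0 0)).
- move=> q Qq; have [q' q0' E] := phi_lift Qq.
  have [M [c [iM L]]] := local_dev_lift al0 al2 be0 be2 phi_mor
    (cyl_UReg al2 UE Qq) (cyl_cont al2 UE phi_cont Qq) (cyl_xc Qq) q0' E.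
  exists (M, c) => /=.
  have cf : \forall x \near q, {for tcyl x, continuous phi}.
    by apply: filterS (cyl_near Qq) => x; exact: (cyl_cont al2 UE phi_cont).
  have := dev_lift_open q0' L cf; apply: filterS => x [q1 [? ? ?]].
  by split => //; exists q1.
- move=> [M c] [M' c'] q Qq /= [iM [q' [q0' E L]]] [iM' [q'' [q0'' E' L']]].
  move=> x Qx [_ [x' [x0' Ex Lx]]]; split => //.
  have [n [S [SE -> ->]]] := dev_lift_glue al0 (cyl_xc Qq) q0' q0'' E E' L L'.
  exists (turn (2 * pi * n%:~R) x'); split; first by rewrite coordE.
    by rewrite tcyl_turn.
  exact: dev_lift_turn.
exists M, c; split; first by have [] := G _ (qbaseQ t0 e0 0).
by move=> q /G[].
Qed.

Lemma dev_axis t r : dev al (mk3 t r 0) = mk3 t r 0.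
Proof.
rewrite /dev; case: (al == 0).
  by apply: vec3P; rewrite !coordE; ring.
by rewrite cylaE tcylE !coordE mulr0 cos0 sin0 mulr1 mulr0.
Qed.

(** Approaching the axis along theta = 0, the radius and the t-coordinate of phi converge while the
    angle of the lift need not. The angle is therefore eliminated: x^2 + y^2 = rho^2 in the massive
    models, and x = rho with a quadratic relation for y in the BTZ model. *)
Lemma axis_image M c : (forall q, Q q -> exists q', [/\ 0 < xc q',
    tcyl q' = phi (tcyl q) & dev_lift al be phi M c q q']) ->
  forall t, `|t - t0| < e ->
    xc (mk3 t 0 0 *m M + c) = 0 /\ yc (mk3 t 0 0 *m M + c) = 0.
Proof.
move=> L t ht.
pose A r := mk3 t r 0 *m M + c.
pose rho r := Defs.radius (phi (mk3 t r 0)).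
pose tau r := tc (phi (mk3 t r 0)).
have cm : {for 0, continuous (fun r : R => mk3 t r 0)}.
  apply: continuous_mk3; [exact: cst_continuous| |exact: cst_continuous].
  exact: cvg_id.
have cphi : {for 0, continuous (fun r : R => phi (mk3 t r 0))}.
  by apply: (continuous_comp cm); apply: phi_cont; exact: (axis_U e0 UE ht).
have crho : {for 0, continuous rho}.
  by apply: (continuous_comp cphi); exact: continuous_radius.
have ctau : {for 0, continuous tau}.
  by apply: (continuous_comp cphi); exact: coord_continuous.
have aff (i : 'I_3) : {for 0, continuous (fun r => A r 0 i)}.
  have -> : (fun r => A r 0 i) = (fun r => t * M 0 i + r * M 1 i + c 0 i).
    apply/funext => r; rewrite /A mxE row_mulmxE sum3E.
    by rewrite !mxE /=; ring.
  apply: continuousD; last exact: cst_continuous.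
  apply: continuousD; first exact: cst_continuous.
  by apply: continuousM; [exact: cvg_id|exact: cst_continuous].
have cA0 : {for 0, continuous (fun r => tc (A r))} := aff 0.
have cA1 : {for 0, continuous (fun r => xc (A r))} := aff 1.
have cA2 : {for 0, continuous (fun r => yc (A r))} := aff 2.
have csq (F : R -> R) : {for 0, continuous F} -> {for 0, continuous (fun r => F r ^+ 2)}.
  move=> cF; apply: (@continuous_comp _ _ _ F (fun y : R => y ^+ 2)) => //.
  exact: exprn_continuous.
have rho0 : rho 0 = 0 by exact: phi_axis.
have lift r : 0 < r < e -> exists q', [/\ xc q' = rho r, tc q' = tau r, 0 < xc q' &
    dev be q' = A r].
  move=> hr; have Qr : Q (mk3 t r 0) by exact: Q_nonempty.
  have [q' [q0' E Lq]] := L _ Qr.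
  have tE : tcyl (mk3 t r 0) = mk3 t r 0 :> vec3 R.
    by rewrite tcylE !coordE cos0 sin0 mulr1 mulr0.
  exists q'; split => //.
  - by rewrite /rho -tE -E radius_tcyl// ltW.
  - by rewrite /tau -tE -E tcylE coordE.
  - by rewrite (dev_lift_center q0' E Lq) dev_axis.
rewrite -/(A 0).
have [b0|b0] := eqVneq be 0.
  have x0 : xc (A 0) = 0.
    apply: etrans rho0; apply: (eq_at0 (F := fun r => xc (A r)) (G := rho) e0) => // r /lift[q' [<- _ _ <-]].
    by rewrite /dev b0 eqxx coordE.
  split => //; apply/eqP; rewrite -sqrf_eq0; apply/eqP.
  (* Since [dev 0] sends (tau, rho, theta) to (tau + rho theta^2 / 2, rho, rho theta), its
     coordinates satisfy y^2 = 2 rho (t - tau). *)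
  transitivity (2 * rho 0 * (tc (A 0) - tau 0)); last by rewrite rho0 mulr0 mul0r.
  apply: (eq_at0 (F := fun r => yc (A r) ^+ 2)
    (G := fun r => 2 * rho r * (tc (A r) - tau r)) e0).
  - exact: csq cA2.
  - apply: continuousM; last exact: continuousB.
    by apply: continuousM => //; exact: cst_continuous.
  - move=> r /lift[q' [<- <- _ <-]].
    by rewrite /dev b0 eqxx !coordE; field.
have E : xc (A 0) ^+ 2 + yc (A 0) ^+ 2 = rho 0 ^+ 2.
  apply: (eq_at0 (F := fun r => xc (A r) ^+ 2 + yc (A r) ^+ 2)
    (G := fun r => rho r ^+ 2) e0).
  - apply: continuousD.
      exact: csq cA1.
    exact: csq cA2.
  - exact: csq crho.
  - move=> r /lift[q' [<- _ q0' <-]].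
    rewrite /dev (negbTE b0) cylaE -radius_sqr radius_tcyl coordE//.
    exact: ltW.
move/eqP: E; rewrite rho0 expr0n /= paddr_eq0 ?sqr_ge0// !sqrf_eq0.
by move=> /andP[/eqP ? /eqP ?].
Qed.

(** A full turn of the source must be a whole number of turns of the target because phi is a
    function on the cylinder, and injectivity of phi leaves only one. The functions T and X are left
    free so that the massive and BTZ forms of phi are both covered. *)
Lemma winding_mu (T X : R -> R -> R) (mu k : R) : 0 < mu ->
  (forall q, Q q -> 0 < X (tc q) (xc q)) ->
  (forall q, Q q -> phi (tcyl q) =
     tcyl (mk3 (T (tc q) (xc q)) (X (tc q) (xc q)) (mu * yc q + k))) -> mu = 1.
Proof.
move=> mu0 X0 E.
pose q := qbase t0 e 0; have Qq : Q q by exact: qbaseQ.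
have q0 := cyl_xc Qq.
have Eturn d : phi (tcyl (turn d q)) = tcyl (turn (mu * d)
    (mk3 (T (tc q) (xc q)) (X (tc q) (xc q)) k)).
  rewrite E; last exact: turn_cyl.
  congr tcyl; rewrite /turn !coordE; congr mk3; rewrite add0r addrC.
  by [].
have Y0 : 0 < xc (mk3 (T (tc q) (xc q)) (X (tc q) (xc q)) k).
  by rewrite coordE; exact: X0.
have E0 : phi (tcyl q) = tcyl (mk3 (T (tc q) (xc q)) (X (tc q) (xc q)) k).
  by rewrite E// {5}/q /qbase coordE mulr0 add0r.
apply: winding_one => //.
  apply: (cos_of_turn Y0); rewrite -Eturn -E0.
  by have := tcyl_turn 1 q; rewrite mulr1 => ->.
move=> x cx; have sx : sin (mu * x) = 0.
  apply/eqP; rewrite -sqrf_eq0; apply/eqP.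
  by have := cos2Dsin2 (mu * x); rewrite cx expr1n; lra.
apply: (cos_of_turn q0); apply: (phi_tcyl_inj al2 UE phi_inj) => //.
  exact: turn_cyl.
rewrite Eturn E0 !tcylE /turn !coordE cosD sinD cx sx.
by rewrite !mulr1 !mulr0 subr0 addr0.
Qed.

End CylinderScrew.


(** * The massive and BTZ cases on a cylinder *)

Section CylinderConclusion.
Context {R : realType}.
Variables (al be : R) (U : set (vec3 R)) (phi : vec3 R -> vec3 R) (t0 e : R).
Hypotheses (al0 : 0 <= al) (al2 : al != 2 * pi) (be0 : 0 <= be) (e0 : 0 < e).
Hypothesis (be2 : be != 2 * pi).
Hypothesis UE : forall p, `|tc p - t0| < e -> Defs.radius p < e -> U p.
Hypothesis phi_cont : forall p, U p -> {for p, continuous phi}.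
Hypothesis phi_mor : E12_morphism al be (U `&` Reg al) phi.
Hypothesis phi_inj : {in U `&` Reg al &, injective phi}.
Hypothesis phi_axis : forall t, `|t - t0| < e -> Defs.radius (phi (mk3 t 0 0)) = 0.
Implicit Types (p q : vec3 R).

Local Notation Q := (cylinder t0 e).

Definition cyl_form (mu d k : R) q : vec3 R := mk3 (tc q + d) (xc q) (mu * yc q + k).

(** The developed equation gives b theta' = a theta + k0 modulo 2 pi only, hence theta' modulo 2 pi
    / b, which does not determine the point. The offset k is therefore read off a lift at each
    point, is locally constant, and is glued modulo 2 pi. *)
Lemma rotation_case (k0 c0 : R) : al != 0 -> be != 0 ->
  (forall q, Q q -> exists q', [/\ 0 < xc q', tcyl q' = phi (tcyl q) &
    dev_lift al be phi (rows3 (mk3 1 0 0) (mk3 0 (cos k0) (sin k0))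
      (mk3 0 (- sin k0) (cos k0))) (mk3 c0 0 0) q q']) ->
  exists k, forall q, Q q ->
    phi (tcyl q) = tcyl (cyl_form (angle_ratio al / angle_ratio be) c0 k q).
Proof.
move=> an bn L; set a := angle_ratio al; set b := angle_ratio be.
have b_gt0 : 0 < b by exact: angle_ratio_gt0.
have bnz := lt0r_neq0 b_gt0.
set mu := a / b.
have bmu y : b * (mu * y) = a * y by rewrite /mu; field.
have devF k x : cos (b * k) = cos k0 -> sin (b * k) = sin k0 ->
    dev be (cyl_form mu c0 k x) = dev al x *m (rows3 (mk3 1 0 0)
      (mk3 0 (cos k0) (sin k0)) (mk3 0 (- sin k0) (cos k0))) + mk3 c0 0 0.
  move=> ck sk; rewrite mul_rows3 /dev (negbTE an) (negbTE bn) !cylaE !tcylE.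
  rewrite /cyl_form !coordE -/a -/b mulrDr bmu cosD sinD ck sk.
  by apply: vec3P; rewrite !coordE; ring.
have [||k G] := @connected_constant_index _ Q R
    (fun k q => \forall x \near q, phi (tcyl x) = tcyl (cyl_form mu c0 k x))
    (@cylinder_connected _ _ _) (@cylinder_open _ _ _)
    (ex_intro _ (qbase t0 e 0) (qbaseQ t0 e0 0)).
- move=> q Qq; have [q' [q0' E Lq]] := L _ Qq.
  have q0 := cyl_xc Qq.
  have Dq := dev_lift_center q0' E Lq.
  (* This offset makes [cyl_form] take the value q' at q; nearby, local injectivity of [dev be]
     identifies it with the lifts of phi. *)
  pose k1 := yc q' - mu * yc q; exists k1; apply: nbhs_interior.
  have ck0 : cos (b * (k0 / b)) = cos k0 by rewrite mulrC divfK.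
  have sk0 : sin (b * (k0 / b)) = sin k0 by rewrite mulrC divfK.
  have := etrans Dq (esym (devF (k0 / b) q ck0 sk0)).
  rewrite /dev (negbTE bn) -/b !cylaE => /tcyl_eq[]; rewrite /cyl_form !coordE//.
  rewrite [b * (_ + _)]mulrDr bmu [b * (k0 / b)]mulrC divfK// => tE xE cE sE.
  have bk1 : b * k1 = b * yc q' - a * yc q by rewrite /k1 mulrBr bmu.
  have kk : a * yc q + k0 - a * yc q = k0 by rewrite addrAC subrr add0r.
  have ck : cos (b * k1) = cos k0 by rewrite bk1 cosB cE sE -cosB kk.
  have sk : sin (b * k1) = sin k0 by rewrite bk1 sinB cE sE -sinB kk.
  have Fq : cyl_form mu c0 k1 q = q'.
    by apply: vec3P; rewrite !coordE// /k1 addrC subrK.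
  have [d d0 inj] := dev_inj_near be0.
  have d2 : 0 < d / 2 by rewrite divr_gt0.
  have Lx := Lq _ (near_yc q' d2).
  have cF : {for q, continuous (cyl_form mu c0 k1)}.
    have c i : {for q, continuous (fun x : vec3 R => x 0 i)} by exact: coord_continuous.
    apply: continuous_mk3; last apply: continuousD; last exact: cst_continuous.
    - by apply: continuousD; [exact: c|exact: cst_continuous].
    - exact: c.
    - by apply: continuousM; [exact: cst_continuous|exact: c].
  have nF : \forall x \near q, `|yc (cyl_form mu c0 k1 x) - yc q'| < d / 2.
    by apply: (cF (fun z => `|yc z - yc q'| < d / 2)); rewrite Fq; exact: near_yc.
  apply: filterS3 (near_xc_gt0 q0) Lx nF => x x0 [q1 [q1y q10 E1 D1]] Fy.
  rewrite -E1; congr tcyl; apply: inj => //; first by rewrite coordE.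
    by rewrite devF.
  move: q1y Fy; rewrite !ltr_norml => /andP[? ?] /andP[? ?].
  by apply/andP; split; lra.
- move=> k k' q Qq /nbhs_singleton E /nbhs_singleton E' x Qx.
  have := etrans (esym E) E' => /tcyl_eq[]; rewrite /cyl_form ?coordE.
  + exact: cyl_xc Qq.
  + exact: cyl_xc Qq.
  move=> _ _ cE sE; have [n nE] := angle_eq_mod cE sE.
  have -> : k' = k + 2 * pi * n%:~R.
    by apply: (@addrI _ (mu * yc q)); rewrite nE addrA.
  apply: filterS => y ->; rewrite -[LHS](tcyl_turn n); congr tcyl.
  by rewrite /turn !coordE addrA.
by exists k => q /G/nbhs_singleton.
Qed.

(** As [dev 0] is injective for r > 0, the developed equation is solved outright. The boost factor l
    multiplies the angle, so the winding argument will force l = 1, which also removes the term in r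
    from the first coordinate. *)
Lemma parabolic_case (l m c0 : R) : al = 0 -> be = 0 -> 0 < l ->
  (forall q, Q q -> exists q', [/\ 0 < xc q', tcyl q' = phi (tcyl q) &
    dev_lift al be phi (rows3 (mk3 l 0 0)
    (mk3 (l * (l^-1 ^+ 2 + m ^+ 2 - 1) / 2) l^-1 m) (mk3 (l * m) 0 1))
    (mk3 c0 0 0) q q']) ->
  forall q, Q q -> phi (tcyl q) =
    tcyl (mk3 (l * tc q + c0 + xc q * (l^-1 - l) / 2) (xc q / l) (l * yc q + l * m)).
Proof.
move=> a0 b0 l0 L q Qq; have [q' [q0' E Lq]] := L _ Qq.
have := dev_lift_center q0' E Lq; rewrite -E mul_rows3 /dev a0 b0 eqxx => D.
have ln := lt0r_neq0 l0.
have tE := congr1 tc D; have xE := congr1 xc D; have yE := congr1 yc D.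
move: tE xE yE; rewrite !coordE => tE xE yE.
have xE' : xc q' = xc q / l by rewrite xE; ring.
have yE' : yc q' = l * yc q + l * m.
  apply: (mulfI (lt0r_neq0 q0')); rewrite yE xE'; by field.
congr tcyl; apply: vec3P; rewrite !coordE//.
move: tE; rewrite xE' yE' => /(canRL (addrK _)) ->; by field.
Qed.

Lemma cylinder_screw : al = be /\
  exists d k, forall q, Q q -> phi (tcyl q) = screw d k (tcyl q).
Proof.
have [M [c [iM L]]] := global_dev_lift al0 al2 be0 e0 be2 UE phi_cont phi_mor.
have A := axis_image e0 UE phi_cont phi_axis L.
have [|h1 h2] := A t0; first by rewrite subrr normr0.
(* A second point of the axis separates the row M 0 of the axis direction from the translation c. *)
have [|h3 h4] := A (t0 + e / 2).
  rewrite addrAC subrr add0r gtr0_norm ?divr_gt0//.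
  by rewrite ltr_pdivrMr// ltr_pMr// ltr1n.
move: h1 h2 h3 h4; rewrite !coordE => h1 h2 h3 h4.
have M01 : M 0 1 = 0.
  by apply: (mulfI (lt0r_neq0 e0)); rewrite mulr0; lra.
have M02 : M 0 2 = 0.
  by apply: (mulfI (lt0r_neq0 e0)); rewrite mulr0; lra.
have cE : c = mk3 (tc c) 0 0.
  by apply: vec3P; rewrite !coordE//; [move: h1; rewrite M01|move: h2; rewrite M02]; lra.
have [_ ab] := iso_form_axis iM M01 M02.
have [a0|an] := eqVneq al 0.
  have b0 : be = 0 by apply/eqP; rewrite -ab a0.
  split; first by rewrite a0 b0.
  move: iM; rewrite a0 b0 eqxx => iM.
  have [l [m [l0 ME]]] := iso_form_parabolic iM M01 M02.
  rewrite ME cE in L.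
  have F := parabolic_case a0 b0 l0 L.
  have l1 : l = 1.
    apply: (winding_mu al2 e0 UE phi_inj
      (T := fun t r => l * t + tc c + r * (l^-1 - l) / 2) (X := fun _ r => r / l)
      (k := l * m) l0) => // q Qq.
    by rewrite divr_gt0// (cyl_xc Qq).
  exists (tc c), m => q Qq; rewrite screw_tcyl F// l1; congr tcyl.
  by apply: vec3P; rewrite !coordE; field.
have bn : be != 0 by rewrite -ab.
move: iM; rewrite (negbTE an) (negbTE bn) => iM.
have [k0 ME] := iso_form_rotation iM M01 M02.
rewrite ME cE in L.
have [k F] := rotation_case an bn L.
have mu1 : angle_ratio al / angle_ratio be = 1.
  apply: (winding_mu al2 e0 UE phi_inj (T := fun t _ => t + tc c)
    (X := fun _ r => r) (k := k)) => //.
  - by rewrite divr_gt0// angle_ratio_gt0.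
  - by move=> q; exact: cyl_xc.
split.
  have rb := lt0r_neq0 (angle_ratio_gt0 be0 bn).
  have : angle_ratio al = angle_ratio be by rewrite -[LHS](divfK rb) mu1 mul1r.
  by move=> /(mulIf _); apply; rewrite invr_eq0 pi2_neq0.
exists (tc c), k => q Qq; rewrite screw_tcyl F// mu1; congr tcyl.
by apply: vec3P; rewrite !coordE; ring.
Qed.

Lemma cylinder_screw_full : al = be /\
  exists d k, forall p, `|tc p - t0| < e -> Defs.radius p < e -> phi p = screw d k p.
Proof.
have [-> [d [k F]]] := cylinder_screw; split => //; exists d, k => p ht hr.
have [r0|r0] := ltP 0 (Defs.radius p).
  have [q [tE xE <-]] := tcyl_surj p; apply: F.
  by split; rewrite ?tE ?xE ?r0.
have p0 : Defs.radius p = 0 by apply/le_anti; rewrite r0 radius_ge0.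
rewrite (radius_eq0 p0).
set t := tc p in ht *.
have cm : {for 0, continuous (fun r : R => mk3 t r 0)}.
  apply: continuous_mk3; [exact: cst_continuous| |exact: cst_continuous].
  exact: cvg_id.
have cphi : {for 0, continuous (fun r : R => phi (mk3 t r 0))}.
  by apply: (continuous_comp cm); apply: phi_cont; exact: (axis_U e0 UE).
have csc : {for 0, continuous (fun r : R => screw d k (mk3 t r 0))}.
  by apply: (continuous_comp cm); exact: continuous_screw.
apply/rowP => i.
apply: (eq_at0 (F := fun r => phi (mk3 t r 0) 0 i)
  (G := fun r => screw d k (mk3 t r 0) 0 i) e0).
- exact: (continuous_comp cphi (@coord_continuous R 1 3 0 i _)).
- exact: (continuous_comp csc (@coord_continuous R 1 3 0 i _)).
move=> r hr'; have Qr : Q (mk3 t r 0) by exact: Q_nonempty.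
have tE : tcyl (mk3 t r 0) = mk3 t r 0 :> vec3 R.
  by rewrite tcylE !coordE cos0 sin0 mulr1 mulr0.
by have := F _ Qr; rewrite tE => ->.
Qed.

End CylinderConclusion.


(** * Isometries of the models *)

Section CkTheory.
Context {R : realType}.
Implicit Types (f g : vec3 R -> vec3 R) (V : set (vec3 R)).

Lemma Ck_ext k V f g : open V -> (forall p, V p -> f p = g p) ->
  Ck k V f -> Ck k V g.
Proof.
move=> oV; elim: k f g => [|k IH] f g fg /=.
  move=> cf p Vp; have nV : \forall x \near p, V x by exact: open_nbhs_nbhs.
  have N : \forall x \near p, f x = g x by apply: filterS nV => x; exact: fg.
  suff : g @ p --> f p by rewrite (fg _ Vp).
  exact: cvg_trans (@near_eq_cvg _ _ (nbhs p) (nbhs_filter p) f g N) (cf _ Vp).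
move=> [df Df].
have dg p : V p -> differentiable g p /\ 'd g p = 'd f p :> (vec3 R -> vec3 R).
  move=> Vp; apply: near_eq_diff (df _ Vp).
  have nV : \forall x \near p, V x by exact: open_nbhs_nbhs.
  by apply: filterS nV => x; exact: fg.
split; first by move=> p /dg[].
move=> i; apply: IH (Df i) => p Vp.
have [dgp E] := dg _ Vp.
apply: etrans (deriveE _ (df _ Vp)) _.
apply: etrans _ (esym (deriveE _ dgp)).
exact: (esym (congr1 (@^~ _) E)).
Qed.

Lemma CkS k V f : Ck k.+1 V f -> forall p, V p -> differentiable f p.
Proof. by case. Qed.

Lemma CkZ k V (a : R) f : open V -> Ck k V f -> Ck k V (fun p => a *: f p).
Proof.
move=> oV; elim: k f => [|k IH] f /=.
  by move=> cf p Vp; exact: (continuousZl_tmp (cf p Vp)).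
move=> [df Df]; split; first by move=> p Vp; exact: (differentiableZ _ (df _ Vp)).
move=> i; apply: Ck_ext (IH _ (Df i)) => // p Vp.
have dp := @diff_derivable _ _ _ _ _ (delta_mx 0 i : vec3 R) (df _ Vp).
by apply/esym; have := deriveZ a dp.
Qed.

Lemma CkD k V f g : open V -> Ck k V f -> Ck k V g -> Ck k V (fun p => f p + g p).
Proof.
move=> oV; elim: k f g => [|k IH] f g /=.
  by move=> cf cg p Vp; exact: (continuousD (cf p Vp) (cg p Vp)).
move=> [df Df] [dg Dg]; split.
  by move=> p Vp; exact: (differentiableD (df _ Vp) (dg _ Vp)).
move=> i; apply: Ck_ext (IH _ _ (Df i) (Dg i)) => // p Vp.
have dp := @diff_derivable _ _ _ _ _ (delta_mx 0 i : vec3 R) (df _ Vp).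
have gp := @diff_derivable _ _ _ _ _ (delta_mx 0 i : vec3 R) (dg _ Vp).
by apply/esym; have := deriveD dp gp.
Qed.

Lemma Ck_cst k V (a : vec3 R) : open V -> Ck k V (fun=> a).
Proof.
move=> oV; elim: k a => [|k IH] a /=.
  by move=> p _; exact: cst_continuous.
split => [p _|i]; first exact: differentiable_cst.
by apply: Ck_ext oV _ (IH 0) => p Vp; rewrite derive_cst.
Qed.

Lemma Ck_id k V : open V -> Ck k V (fun p => p).
Proof.
case: k => [|k] oV /=; first by move=> p _; exact: cvg_id.
split => [p _ //|i].
by apply: Ck_ext oV _ (Ck_cst k (delta_mx 0 i) oV) => p _; rewrite derive_id.
Qed.

Lemma continuous_affine (N : 'M[R]_3) (b : vec3 R) :
  continuous (fun x : vec3 R => x *m N + b).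
Proof.
move=> p; apply: differentiable_continuous.
exact: (@ex_diff _ _ _ _ _ _ _ (is_diff_affine N b p)).
Qed.

Lemma vec_sum3 (A : 'M[R]_3) (D : vec3 R -> vec3 R) (v : vec3 R) :
  (forall w, w *m A = D w) ->
  v 0 0 *: D (delta_mx 0 0) + v 0 1 *: D (delta_mx 0 1) + v 0 2 *: D (delta_mx 0 2)
  = D v.
Proof.
move=> E; rewrite -!E !scalemxAl -!mulmxDl; congr (_ *m _).
by apply/rowP; apply: ord3_ind; rewrite !mxE /=; ring.
Qed.

(** The partial derivatives of the composite are combinations, with constant coefficients, of
    partial derivatives of f composed with the same affine map, so the induction on k closes without
    a product rule. *)
Lemma Ck_affine k V f (N : 'M[R]_3) (b : vec3 R) : open V -> Ck k V f ->
  Ck k [set p | V (p *m N + b)] (fun p => f (p *m N + b)).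
Proof.
move=> oV; pose T (p : vec3 R) : vec3 R := p *m N + b.
have oT : open [set p | V (T p)].
  by apply: open_comp => // x _; exact: continuous_affine.
elim: k f => [|k IH] f.
  move=> cf p Vp; apply: (@continuous_comp _ _ _ T f); first exact: continuous_affine.
  exact: cf.
move=> Cf; have df := CkS Cf.
have Df i : Ck k V ('D_(delta_mx 0 i) f) by case: Cf => _; apply.
have dT p := is_diff_affine N b p.
have dfT p : V (T p) -> differentiable (f \o T) p.
  move=> Vp; apply: differentiable_comp; last exact: df.
  exact: (@ex_diff _ _ _ _ _ _ _ (dT p)).
split; [by move=> p; exact: dfT|move=> i].
pose n j := (delta_mx 0 i *m N : vec3 R) 0 j.
have C3 : Ck k V (fun p => n 0 *: 'D_(delta_mx 0 0) f p + n 1 *: 'D_(delta_mx 0 1) f p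
  + n 2 *: 'D_(delta_mx 0 2) f p).
  exact: CkD oV (CkD oV (CkZ (n 0) oV (Df 0)) (CkZ (n 1) oV (Df 1)))
    (CkZ (n 2) oV (Df 2)).
apply: Ck_ext (IH _ C3) => // p Vp.
apply: esym; apply: etrans (deriveE _ (dfT _ Vp)) _.
apply: etrans (diff_comp_is _ (dT p) (df _ Vp)) _.
apply: etrans (esym (vec_sum3 _ (mul_jacobian f _))) _.
congr (_ *: _ + _ *: _ + _ *: _); exact: (esym (deriveE _ (df _ Vp))).
Qed.

End CkTheory.

Lemma diff_scale_comp_is (R : realType) (U V W : normedModType R) (a : R)
    (f : V -> W) (g dg : U -> V) (p v : U) :
  is_diff p g dg -> differentiable f (g p) ->
  'd (fun x => a *: f (g x)) p v = a *: 'd f (g p) (dg v).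
Proof.
move=> dgp df; have [dp _] := dgp.
rewrite -(diff_comp_is v dgp df).
by have := diffZ a (differentiable_comp dp df) => /(congr1 (@^~ v)).
Qed.

(** * Similarities fixing the axis, and transport of charts *)

Section Similarities.
Context {R : realType}.
Implicit Types (al c d k : R) (p q v : vec3 R) (V : set (vec3 R)) (psi : vec3 R -> vec3 R).

(** The homothety of ratio c composed with the rotation of angle k about the axis, acting on row
    vectors. All three terms of the model metrics are homogeneous of degree 2 under it. *)
Definition simmx c k : 'M[R]_3 := rows3 (mk3 c 0 0)
  (mk3 0 (c * cos k) (c * sin k)) (mk3 0 (- (c * sin k)) (c * cos k)).

Definition sim c d k p : vec3 R := p *m simmx c k + mk3 d 0 0.

Lemma sim_coord c d k p : sim c d k p =
  mk3 (c * tc p + d) (c * (xc p * cos k - yc p * sin k))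
    (c * (xc p * sin k + yc p * cos k)).
Proof. by rewrite /sim mul_rows3; apply: vec3P; rewrite !coordE; ring. Qed.

Lemma screwE d k p : screw d k p = sim 1 d k p.
Proof. by rewrite sim_coord /screw; congr mk3; ring. Qed.

Lemma sim_tcyl c d k q :
  sim c d k (tcyl q) = tcyl (mk3 (c * tc q + d) (c * xc q) (yc q + k)).
Proof.
by rewrite sim_coord !tcylE !coordE cosD sinD; apply: vec3P; rewrite !coordE; ring.
Qed.

Lemma radius_sim c d k p : 0 < c -> Defs.radius (sim c d k p) = c * Defs.radius p.
Proof.
move=> c0; have [q [_ qr <-]] := tcyl_surj p.
have q0 : 0 <= xc q by rewrite qr radius_ge0.
by rewrite sim_tcyl !radius_tcyl ?coordE// mulr_ge0// ltW.
Qed.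

Lemma simK c d k : c != 0 -> cancel (sim c d k) (sim c^-1 (- (d / c)) (- k)).
Proof.
move=> c0 p; have [q [_ _ <-]] := tcyl_surj p.
rewrite !sim_tcyl !coordE; congr tcyl; apply: vec3P; rewrite !coordE; by field.
Qed.

Lemma det_simmx c k : \det (simmx c k) = c ^+ 3.
Proof.
rewrite det3E !mxE /=.
rewrite -[RHS]mulr1 -[in RHS](cos2Dsin2 k); ring.
Qed.

Lemma metric_sim al c d k p v : al != 2 * pi -> 0 < c -> 0 < Defs.radius p ->
  metric al (sim c d k p) (v *m simmx c k) = c ^+ 2 * metric al p v.
Proof.
move=> al2 c0 r0.
have rE := radius_sim d k p c0.
have cn := lt0r_neq0 c0; have rn := lt0r_neq0 r0.
have vE : v *m simmx c k = sim c 0 k v by rewrite /sim (_ : mk3 0 0 0 = 0) ?addr0//;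
  apply: vec3P; rewrite !coordE.
have cs := cos2Dsin2 k.
have drE : dr (sim c d k p) (v *m simmx c k) = c * dr p v.
  rewrite /dr rE vE !sim_coord !coordE.
  transitivity (c * ((cos k ^+ 2 + sin k ^+ 2) * (xc p * xc v + yc p * yc v) /
    Defs.radius p)); last by rewrite cs mul1r.
  by field; rewrite cn rn.
have dthE : dtheta (sim c d k p) (v *m simmx c k) = dtheta p v.
  rewrite /dtheta rE vE !sim_coord !coordE.
  transitivity ((cos k ^+ 2 + sin k ^+ 2) * (xc p * yc v - yc p * xc v) /
    Defs.radius p ^+ 2); last by rewrite cs mul1r.
  by field; rewrite cn rn.
have tE : tc (v *m simmx c k) = c * tc v by rewrite vE sim_coord coordE addr0.
rewrite /metric (negbTE al2) drE dthE rE tE.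
by case: ifP => _; ring.
Qed.

(** The factor 1 / c in front of psi compensates the factor c^2 by which the similarity multiplies
    the metric. *)
Lemma is_chart_sim al V psi c d k : al != 2 * pi -> 0 < c -> is_chart al V psi ->
  is_chart al [set p | V (sim c d k p)] (fun p => c^-1 *: psi (sim c d k p)).
Proof.
move=> al2 c0 [[oV VR] inj Cpsi Jpsi dpsi].
have cn := lt0r_neq0 c0.
have oT : open [set p | V (sim c d k p)].
  by apply: open_comp => // x _; exact: continuous_affine.
have Creg p : V (sim c d k p) -> 0 < Defs.radius p.
  by move=> /VR/(RegP _ al2); rewrite radius_sim// pmulr_rgt0.
have dT p : is_diff p (sim c d k) (fun v => v *m simmx c k).
  exact: is_diff_affine.
have dd p : V (sim c d k p) -> differentiable psi (sim c d k p).
  by move=> Vp; exact: (CkS (Cpsi 1%N) Vp).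
have dE p v : V (sim c d k p) ->
    'd (fun p => c^-1 *: psi (sim c d k p)) p v =
    c^-1 *: 'd psi (sim c d k p) (v *m simmx c k).
  by move=> Vp; exact: diff_scale_comp_is (dT p) (dd _ Vp).
split.
- by split => // p /Creg r0; apply/RegP.
- move=> p q; rewrite !inE => Vp Vq /(scalerI _) E.
  apply: (can_inj (simK d k cn)); apply: inj; rewrite ?inE//.
  by apply: E; rewrite invr_eq0.
- by move=> n; apply: CkZ => //; exact: Ck_affine.
- move=> p Vp.
  have -> : jacobian (fun p => c^-1 *: psi (sim c d k p)) p =
      c^-1 *: (simmx c k *m jacobian psi (sim c d k p)).
    apply: eq_mulmx3 => v; apply: etrans (mul_jacobian _ _ _) _.
    apply: etrans (dE _ _ Vp) _; rewrite -scalemxAr mulmxA.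
    by congr (_ *: _); exact: esym (mul_jacobian _ _ _).
  rewrite detZ det_mulmx det_simmx !mulr_gt0 ?exprn_gt0 ?invr_gt0//.
  exact: Jpsi.
move=> p Vp; have [d1 d2] := dpsi _ Vp; split => v.
  apply: etrans (congr1 mink (dE _ v Vp)) _.
  have minkZ (a : R) (w : vec3 R) : mink (a *: w) = a ^+ 2 * mink w.
    by rewrite /mink !coordE; ring.
  rewrite minkZ; apply: etrans (congr1 _ (d1 _)) _.
  by rewrite metric_sim// ?Creg//; field.
move=> [v0 tv].
have [|m0 t0] := d2 (v *m simmx c k).
  split; first by rewrite metric_sim ?Creg// pmulr_rle0// exprn_gt0.
  by rewrite mul_rows3 !coordE !mulr0 !addr0 mulr_gt0.
have futZ (a : R) (w w' : vec3 R) : 0 < a -> w' = a *: w -> mink w <= 0 -> 0 < tc w ->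
    future_causal w'.
  move=> a0 -> w0 tw; split; last by rewrite coordE mulr_gt0.
  rewrite (_ : mink _ = a ^+ 2 * mink w); last by rewrite /mink !coordE; ring.
  by rewrite pmulr_rle0// exprn_gt0.
by apply: (futZ c^-1 _ _ _ (dE _ v Vp)) => //; rewrite invr_gt0.
Qed.

(** These similarities act transitively on the regular points: c matches the radii, d the heights
    and k the angles. One chart thus yields a chart around every regular point. *)
Lemma chart_transport al V psi p1 p2 : al != 2 * pi -> is_chart al V psi -> V p1 ->
  Reg al p2 -> exists V2 psi2, is_chart al V2 psi2 /\ V2 p2.
Proof.
move=> al2 cV V1 /(RegP _ al2) r2.
have r1 : 0 < Defs.radius p1 by apply/(RegP _ al2); case: cV => -[_ h] _ _ _ _; exact: h.
have [q1 [_ x1 E1]] := tcyl_surj p1; have [q2 [_ x2 E2]] := tcyl_surj p2.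
pose c := xc q1 / xc q2.
have c0 : 0 < c by rewrite divr_gt0// ?x1 ?x2.
set d := tc q1 - c * tc q2; set k := yc q1 - yc q2.
exists [set p | V (sim c d k p)], (fun p => c^-1 *: psi (sim c d k p)).
split; first exact: (is_chart_sim d k al2 c0 cV).
rewrite /= -E2 sim_tcyl (_ : mk3 _ _ _ = q1) ?E1//.
have n2 : xc q2 != 0 by rewrite x2 lt0r_neq0.
by apply: vec3P; rewrite !coordE /d /k /c; field.
Qed.

Lemma is_chart_id : is_chart (2 * pi : R) setT (fun p => p).
Proof.
have di (p : vec3 R) : is_diff p (fun x : vec3 R => x) (fun v => v).
  exact: is_diff_id.
have dE (p v : vec3 R) : 'd (fun x : vec3 R => x) p v = v.
  by rewrite (@diff_val _ _ _ _ _ _ _ (di p)).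
split.
- by split; [exact: openT|move=> p _ []; rewrite eqxx].
- by move=> p q _ _.
- by move=> k; apply: Ck_id; exact: openT.
- move=> p _; rewrite (_ : jacobian _ p = 1%:M) ?det1//.
  by apply: eq_mulmx3 => v; rewrite mul_jacobian dE mulmx1.
move=> p _; split => v; first by rewrite dE /metric eqxx.
by rewrite dE /model_future_causal /metric eqxx.
Qed.

(** Between a chart at x and the same chart composed with the inverse screw, taken at the image of
    x, the screw reads as the identity. The given chart is only a seed for [chart_transport]. *)
Lemma isom_model_screw al V psi p d k : al != 2 * pi -> is_chart al V psi -> V p ->
  isom_model al (screw d k).
Proof.
move=> al2 cV Vp.
have sc d' k' : screw d' k' = sim 1 d' k' by apply/funext => x; exact: screwE.
have scK d' k' : cancel (screw d' k') (screw (- d') (- k')).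
  move=> x; rewrite !sc; have := simK d' k' (oner_neq0 R) x.
  by rewrite invr1 mulr1.
have ccont d' k' : continuous (screw d' k').
  by rewrite sc; move=> x; exact: continuous_affine.
have reg d' k' x : Reg al x -> Reg al (screw d' k' x).
  by move=> /(RegP _ al2) r; apply/RegP => //; rewrite sc radius_sim ?mul1r.
have mor d' k' : E12_morphism al al (Reg al) (screw d' k').
  split; first by move=> _ [x Rx <-]; exact: reg.
  move=> x Rx; have [V2 [psi2 [c2 Vx]]] := chart_transport al2 cV Vp Rx.
  have c3 := is_chart_sim (- d') (- k') al2 ltr01 c2.
  exists V2, psi2, [set p | V2 (sim 1 (- d') (- k') p)],
    (fun p => 1^-1 *: psi2 (sim 1 (- d') (- k') p)), id; split.
  - by split.
  - split; first exact: c3.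
    by rewrite /= -sc scK.
  - exists 1%:M, 0; split.
    + by move=> y; rewrite mulmx1 addr0.
    + by move=> v; rewrite mulmx1.
    + by rewrite det1.
    + by move=> v; rewrite mulmx1.
  - have [[oV2 _] _ _ _ _] := c2.
    have nV : \forall y \near x, V2 y by exact: open_nbhs_nbhs.
    by apply: filterS nV => y V2y; rewrite /= -sc scK invr1 scale1r.
have scK' : cancel (screw (- d) (- k)) (screw d k).
  by have := scK (- d) (- k); rewrite !opprK.
exists (screw (- d) (- k)); split => //.
apply/seteqP; split => [_ [x Rx <-]|x Rx]; first exact: reg.
by exists (screw (- d) (- k) x); [exact: reg|exact: scK'].
Qed.

End Similarities.


(** * Continuation along U *)

Section ScrewUniqueness.
Context {R : realType}.

Lemma affine_near_eq (N N' : 'M[R]_3) (b b' x : vec3 R) :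
  (\forall y \near x, y *m N + b = y *m N' + b') -> N = N' /\ b = b'.
Proof.
move=> E; have NN : N = N'.
  have [_ h] := near_eq_diff E (@ex_diff _ _ _ _ _ _ _ (is_diff_affine N b x)).
  have {}h := etrans (esym (@diff_val _ _ _ _ _ _ _ (is_diff_affine N' b' x)))
    (etrans h (@diff_val _ _ _ _ _ _ _ (is_diff_affine N b x))).
  by apply: eq_mulmx3 => v; exact: esym (congr1 (@^~ v) h).
by split => //; have := nbhs_singleton E; rewrite NN => /addrI.
Qed.

(** Equality is one of maps and not of parameters, since k matters only modulo 2 pi. *)
Lemma screw_near_eq (d k d' k' : R) (x : vec3 R) :
  (\forall y \near x, screw d k y = screw d' k' y) -> screw d k =1 screw d' k'.
Proof.
move=> E; have [|NN bb] := @affine_near_eq (simmx 1 k) (simmx 1 k') (mk3 d 0 0)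
    (mk3 d' 0 0) x.
  by apply: filterS E => y; rewrite !screwE.
by move=> y; rewrite !screwE /sim NN bb.
Qed.

Lemma dev_screw al (d k : R) : exists S, forall q,
  dev al (mk3 (tc q + d) (xc q) (yc q + k)) = dev al q *m S + mk3 d 0 0.
Proof.
have [S SE] := dev_turn al k; exists S => q; rewrite -SE /dev /turn.
case: ifP => _; first by apply: vec3P; rewrite !coordE; ring.
by rewrite /cyla /cyl; apply: vec3P; rewrite !coordE; ring.
Qed.

End ScrewUniqueness.

(** * Rigidity near a singular point *)

Section LocalRigidity.
Context {R : realType}.
Variables (al be : R) (U : set (vec3 R)) (phi : vec3 R -> vec3 R).
Hypotheses (al0 : 0 <= al) (al2 : al != 2 * pi) (be0 : 0 <= be).
Hypothesis oU : open U.
Hypothesis phi_cont : forall p, U p -> {for p, continuous phi}.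
Hypothesis phi_mor : E12_morphism al be (U `&` Reg al) phi.
Hypothesis phi_inj : {in U `&` Reg al &, injective phi}.
Implicit Types (p q : vec3 R).

Lemma axis_nbhs t0 (N : set (vec3 R)) : nbhs (mk3 t0 0 0) N ->
  exists2 e, 0 < e & forall p, `|tc p - t0| < e -> Defs.radius p < e -> N p.
Proof.
move=> /nbhs_ballP[e /= e0 eN]; exists e => // p ht hr; apply: eN.
have sq_le (a b : R) : 0 <= b -> a ^+ 2 <= b ^+ 2 -> `|a| <= b.
  by move=> b0 h; rewrite -(@ler_pXn2r _ 2)// ?nnegrE// -normrX ger0_norm// sqr_ge0.
have xr : `|xc p| < e.
  apply: le_lt_trans hr; apply: sq_le; first exact: radius_ge0.
  by rewrite radius_sqr lerDl sqr_ge0.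
have yr : `|yc p| < e.
  apply: le_lt_trans hr; apply: sq_le; first exact: radius_ge0.
  by rewrite radius_sqr lerDr sqr_ge0.
split => // i; rewrite ord1; apply: ord3_ind; rewrite -ball_normE /= mxE /=.
- by rewrite distrC.
- by rewrite sub0r normrN.
- by rewrite sub0r normrN.
Qed.

Lemma local_screw p0 : U p0 -> Defs.radius p0 = 0 ->
  al = be /\ exists d k, \forall p \near p0, phi p = screw d k p.
Proof.
move=> Up0 /radius_eq0 p0E; set t0 := tc p0 in p0E; rewrite p0E in Up0 *.
have [e e0 UE] := axis_nbhs (open_nbhs_nbhs (conj oU Up0)).
have axis : be != 2 * pi /\
    forall t, `|t - t0| < e -> Defs.radius (phi (mk3 t 0 0)) = 0.
  (* One value outside [Reg be] already excludes be = 2 pi, for which every point is regular. *)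
  suff H t : `|t - t0| < e -> ~ Reg be (phi (mk3 t 0 0)).
    have b2 : be != 2 * pi.
      apply/negP => /eqP b2; apply: (H t0); first by rewrite subrr normr0.
      by move=> []; rewrite b2 eqxx.
    split => // t /H nR; apply/eqP; rewrite eq_le radius_ge0 andbT leNgt.
    by apply/negP => /(RegP _ b2).
  move=> ht Rt.
  (* For be = 2 pi the identity is a chart; otherwise the morphism property at a regular point of
     the cylinder gives a chart of the target, which is transported to the value on the axis. *)
  have [V [psi [cV Vt]]] : exists V psi, is_chart be V psi /\ V (phi (mk3 t 0 0)).
    have [b2|b2] := eqVneq be (2 * pi).
      by exists setT, (fun p => p); rewrite b2; split => //; exact: is_chart_id.
    have Qq := qbaseQ t0 e0 0.
    have [_ mor] := phi_mor; have := mor _ (cyl_UReg al2 UE Qq).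
    move=> [_ [_ [V [psi [_ [_ [cV Vp] _ _]]]]]].
    exact: chart_transport b2 cV Vp Rt.
  have Ut : U (mk3 t 0 0) by exact: (axis_U e0 UE).
  have oV : open V by case: cV => -[].
  have nV : \forall p \near mk3 t 0 0, U p /\ V (phi p).
    apply: filterI; first exact: open_nbhs_nbhs.
    exact: (phi_cont Ut (open_nbhs_nbhs (conj oV Vt))).
  have [e1 e10 E1] := axis_nbhs nV.
  have U1 p : `|tc p - t| < e1 -> Defs.radius p < e1 -> U p.
    by move=> h1 h2; have [] := E1 p h1 h2.
  apply: (chart_image_absurd al0 al2 e10 U1 phi_cont phi_mor phi_inj cV).
  move=> q [h1 /andP[h2 h3]].
  apply: (E1 _ _ _).2; rewrite ?radius_tcyl ?ltW// tcylE coordE//.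
have [be2 ax] := axis.
have [-> [d [k F]]] := cylinder_screw_full al0 al2 be0 e0 be2 UE phi_cont phi_mor
  phi_inj ax.
split => //; exists d, k.
have nr : \forall p \near mk3 t0 0 0, Defs.radius p < e.
  have h0 : Defs.radius (mk3 t0 0 0 : vec3 R) < e.
    by rewrite /Defs.radius !coordE expr0n addr0 sqrtr0.
  exact: (continuous_radius (lt_nbhsl h0)).
have nt : \forall p \near mk3 t0 0 0, `|tc p - t0| < e.
  have c : {for mk3 t0 0 0, continuous (fun x : vec3 R => `|tc x - t0|)}.
    apply: continuous_comp; last exact: norm_continuous.
    by apply: continuousB; [exact: coord_continuous|exact: cst_continuous].
  by apply: (c _ (lt_nbhsl _)); rewrite coordE subrr normr0.
by apply: filterS2 nt nr => p; exact: F.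
Qed.

End LocalRigidity.

(** * Continuation through regular points *)

Section Continuation.
Context {R : realType}.
Variables (al : R) (U : set (vec3 R)) (phi : vec3 R -> vec3 R) (d k : R).
Hypotheses (al0 : 0 <= al) (al2 : al != 2 * pi) (oU : open U).
Hypothesis phi_cont : forall p, U p -> {for p, continuous phi}.
Hypothesis phi_mor : E12_morphism al al (U `&` Reg al) phi.

Lemma screw_eq_closed p : {for p, continuous phi} ->
  (forall N, nbhs p N -> exists2 x, N x & phi x = screw d k x) -> phi p = screw d k p.
Proof.
move=> cf acc; apply/eqP; rewrite -subr_eq0; apply/negPn/negP => n0.
have c : {for p, continuous (fun x => phi x - screw d k x)}.
  by apply: continuousB => //; exact: continuous_screw.
have o : open [set v : vec3 R | v != 0].
  rewrite (_ : [set v | v != 0] = ~` [set 0]); last first.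
    by apply/seteqP; split => v /= /eqP.
  by apply: closed_openC; apply: accessible_closed_set1; apply: hausdorff_accessible;
     exact: norm_hausdorff.
have [x nx E] := acc _ (c _ (open_nbhs_nbhs (conj o n0))).
by move: nx; rewrite /= E subrr eqxx.
Qed.

(* Seen through [dev al], both [phi] and the screw motion are affine near [p],
   and they agree on a nonempty open set. *)
Lemma screw_continuation p : U p -> Reg al p ->
  (forall N, nbhs p N -> exists2 x, N x & \forall y \near x, phi y = screw d k y) ->
  \forall x \near p, phi x = screw d k x.
Proof.
move=> Up Rp acc.
have pE : phi p = screw d k p.
  apply: screw_eq_closed; first exact: phi_cont.
  by move=> N /acc[x Nx /nbhs_singleton E]; exists x.
have [q [_ qr Eq]] := tcyl_surj p.
have q0 : 0 < xc q by rewrite qr; apply/(RegP _ al2).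
pose F x : vec3 R := mk3 (tc x + d) (xc x) (yc x + k).
have hF x : screw d k (tcyl x) = tcyl (F x) by exact: screw_tcyl.
have [M [c [_ L]]] := @local_dev_lift R al al (U `&` Reg al) phi q (F q) al0 al2 al0 al2
  phi_mor ltac:(by rewrite Eq) ltac:(by rewrite Eq; exact: phi_cont) q0
  ltac:(by rewrite coordE) ltac:(by rewrite -hF Eq pE).
have [d0 d0_gt0 inj] := dev_inj_near al0.
(* Two angular errors below this bound add up to less than 2 pi and less than d0, so that both
   [tcyl_inj_near] and the local injectivity of [dev al] apply. *)
have p2 : 0 < Num.min pi (d0 / 2) :> R by rewrite lt_min pi_gt0 divr_gt0.
have LN := L _ (near_yc (F q) p2).
have nF : \forall x \near q, `|yc (F x) - yc (F q)| < Num.min pi (d0 / 2).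
  apply: filterS (near_yc q p2) => x.
  by rewrite !coordE (_ : yc x + k - _ = yc x - yc q)//; ring.
have lifts : \forall x \near q, exists q1, [/\ 0 < xc x /\ 0 < xc q1,
    tcyl q1 = phi (tcyl x), `|yc q1 - yc (F x)| < 2 * pi,
    `|yc q1 - yc (F x)| < d0 & dev al q1 = dev al x *m M + c].
  apply: filterS3 LN nF (near_xc_gt0 q0) => x [q1 [h1 q10 E1 D1]] h2 x0.
  have {h1 h2}h : `|yc q1 - yc (F x)| < Num.min pi (d0 / 2) + Num.min pi (d0 / 2).
    rewrite -(subrKA (yc (F q))) (le_lt_trans (ler_normD _ _))// ltrD//.
    by rewrite distrC.
  exists q1; split => //; apply: lt_le_trans h _.
    by rewrite mulr_natl mulr2n lerD// ge_min lexx.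
  by rewrite [leRHS]splitr lerD// ge_min lexx orbT.
have [S SE] := dev_screw al d k.
have [x [x0 [L2 nx]]] : exists x, 0 < xc x /\
   ((\forall y \near x, exists q1, [/\ 0 < xc y /\ 0 < xc q1,
    tcyl q1 = phi (tcyl y), `|yc q1 - yc (F y)| < 2 * pi,
    `|yc q1 - yc (F y)| < d0 & dev al q1 = dev al y *m M + c]) /\
    (\forall y \near x, phi (tcyl y) = tcyl (F y))).
  have := tcyl_open q0 (nbhs_interior lifts); rewrite Eq => /acc[z [x Lx Ex] nz].
  exists x; split; last split => //.
    by have [q1 [[]]] := nbhs_singleton Lx.
  have : \forall y \near x, phi (tcyl y) = screw d k (tcyl y).
    by rewrite -Ex in nz; exact: (continuous_tcyl nz).
  by apply: filterS => y; rewrite hF.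
have [|SM cE] := @dev_affine_inj R al x S M (mk3 d 0 0) c al0 x0.
  apply: filterS2 L2 nx => y [q1 [[y0 q10] E1 h1 h2 D1]] E2.
  rewrite -SE -D1; congr (dev al _); apply: tcyl_inj_near => //.
  - by rewrite coordE.
  - by rewrite E1 E2.
have done : \forall x \near q, phi (tcyl x) = screw d k (tcyl x).
  apply: filterS lifts => y [q1 [[y0 q10] E1 h1 h2 D1]].
  rewrite hF -E1; congr tcyl; apply/esym; apply: inj => //; first by rewrite coordE.
  by rewrite D1 SE SM cE.
by have := tcyl_open q0 done; rewrite Eq; apply: filterS => y [z Ez <-].
Qed.

End Continuation.

Theorem proposition1p19 (R : realType) (alpha beta : R)
    (alpha_ge0 : 0 <= alpha) (beta_ge0 : 0 <= beta)
    (alpha_neq : alpha != 2 * pi)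
    (U : set (vec3 R)) (U_open : open U) (U_conn : connected U)
    (U_sing : U `&` Sing alpha !=set0)
    (phi : vec3 R -> vec3 R) (phi_cont : {within U, continuous phi})
    (phi_mor : E12_morphism alpha beta (U `&` Reg alpha) phi)
    (phi_inj : {in U `&` Reg alpha &, injective phi}) :
  alpha = beta /\
  exists h : vec3 R -> vec3 R, isom_model alpha h /\ {in U, phi =1 h}.
Proof.
have phi_c p : U p -> {for p, continuous phi}.
  by move=> Up; move: phi_cont; rewrite continuous_open_subspace// => /(_ p); apply;
     rewrite inE.
have [p0 [Up0 [_ r0]]] := U_sing.
have [ab [d [k near_p0]]] := local_screw alpha_ge0 alpha_neq beta_ge0 U_open phi_c
  phi_mor phi_inj Up0 r0.
subst beta; split => //; exists (screw d k); split.
  (* A regular point of U close to p0 is needed: the morphism property there supplies the chart from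
     which the screw is shown to be an isometry. *)
  have [e e0 UE] : exists2 e, 0 < e & forall p, `|tc p - tc p0| < e ->
      Defs.radius p < e -> U p.
    by apply: axis_nbhs; rewrite -radius_eq0//; exact: open_nbhs_nbhs.
  have [_ mor] := phi_mor.
  have [V [psi [_ [_ [_ [[cV Vp] _ _ _]]]]]] :=
    mor _ (cyl_UReg alpha_neq UE (qbaseQ (tc p0) e0 0)).
  exact: isom_model_screw alpha_neq cV Vp.
pose agree (p : vec3 R) := \forall x \near p, phi x = screw d k x.
(* Agreement passes to limit points. On the axis a new screw is obtained from the local result; it
   agrees with the old one near some point, hence everywhere. *)
have continuation p : U p ->
    (forall N, nbhs p N -> exists2 x, N x & agree x) -> agree p.
  move=> Up acc; have [rp|rp] := ltP 0 (Defs.radius p).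
    by apply: (screw_continuation alpha_ge0 alpha_neq phi_c phi_mor Up) => //;
       apply/(RegP _ alpha_neq).
  have rp0 : Defs.radius p = 0 by apply/le_anti; rewrite rp radius_ge0.
  have [_ [d' [k' E']]] := local_screw alpha_ge0 alpha_neq beta_ge0 U_open phi_c
    phi_mor phi_inj Up rp0.
  have [x Ex ax] := acc _ (nbhs_interior E').
  have ss : screw d' k' =1 screw d k.
    by apply: (@screw_near_eq R d' k' d k x); apply: filterS2 Ex ax => y <-.
  by apply: filterS E' => y ->; exact: ss.
(* Agreement near a point is an open condition, and [continuation] makes its failure open in U as
   well, so its truth value is a locally constant index. *)
have [||[] G] := @connected_constant_index _ U bool
    (fun b p => if b then agree p else ~ agree p) U_conn U_open (ex_intro _ p0 Up0).
- move=> p Up; have [ap|nap] := pselect (agree p).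
    by exists true; exact: nbhs_interior ap.
  exists false; apply: contrapT => nN; apply: nap; apply: continuation => // N pN.
  apply: contrapT => nx; apply: nN; apply: filterS pN => x Nx ax.
  by apply: nx; exists x.
- by move=> [] [] p _.
- by move=> p; rewrite inE => /G/nbhs_singleton.
- by case: (G _ Up0).
Qed.
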